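(* Let $U=\{u_1,\dots,u_n\}$ and $V=\{v_1,\dots,v_m\}$ be disjoint finite sets, and let $0<c_1\le c_2<n$ and $0<d_1\le d_2<m$ be integers. Let $\mathbf d$ be a bipartite degree sequence on $U\uplus V$ which has at least one realization (a simple bipartite graph with classes $U,V$ in which each vertex has its prescribed degree) and satisfies $$c_1\le d(v)\le c_2\quad\forall v\in V,\qquad d_1\le d(u)\le d_2\quad\forall u\in U.$$ Assume furthermore that $$(c_2-c_1-1)(d_2-d_1-1)\le \max\{\,c_1(m-d_2),\ d_1(n-c_2)\,\}.$$ Then the swap Markov chain on the set of realizations of $\mathbf d$ is rapidly mixing.
   Context: Swap Markov chain on bipartite degree sequences: the state space $\mathcal G(\mathbf d)$ is the set of all simple bipartite graphs on vertex classes $U,V$ realizing $\mathbf d$. From the current realization $G$: with probability $1/2$ stay at $G$; with probability $1/2$ choose uniformly at random a $2$-subset $\{u_1,u_2\}\subseteq U$ and a $2$-subset $\{v_1,v_2\}\subseteq V$; if $u_1v_1,u_2v_2\in E(G)$ and $u_1v_2,u_2v_1\notin E(G)$, replace the edges $u_1v_1,u_2v_2$ by $u_1v_2,u_2v_1$ (a swap); similarly if $u_1v_2,u_2v_1\in E(G)$ and $u_1v_1,u_2v_2\notin E(G)$, replace $u_1v_2,u_2v_1$ by $u_1v_1,u_2v_2$; otherwise stay. Thus for $G'\neq G$ obtained from $G$ by one swap, $P(G\to G')=1/\big(2\binom{n}{2}\binom{m}{2}\big)$. This chain is irreducible, aperiodic and symmetric, with the uniform stationary distribution $\pi$. Rapidly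 mixing means: the mixing time $\tau(\varepsilon)=\max_{G}\min\{t:\ \|P^t(G,\cdot)-\pi\|_{TV}\le\varepsilon\}$ is bounded by a polynomial in $n+m$ and $\log(1/\varepsilon)$, the polynomial being uniform over all degree sequences satisfying the hypotheses. *)

(* Defs.v *)
From Stdlib Require Import Reals ZArith.
From mathcomp Require Import all_boot.

Set Implicit Arguments.
Unset Strict Implicit.
Unset Printing Implicit Defensive.

(* U = 'I_n, V = 'I_m; a simple bipartite graph on U,V is its edge set. *)
Definition bgraph (n m : nat) := {set 'I_n * 'I_m}.

Definition degU (n m : nat) (G : {set 'I_n * 'I_m}) (u : 'I_n) : nat :=
  #|[set v : 'I_m | (u, v) \in G]|.

Definition degV (n m : nat) (G : {set 'I_n * 'I_m}) (v : 'I_m) : nat :=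
  #|[set u : 'I_n | (u, v) \in G]|.

Definition realizes (n m : nat) (du : 'I_n -> nat) (dv : 'I_m -> nat)
  (G : {set 'I_n * 'I_m}) : bool :=
  [forall u, degU G u == du u] && [forall v, degV G v == dv v].

(* H is obtained from G by one swap (u1v1,u2v2 -> u1v2,u2v1).  The second
   case of the informal definition is this one with v1,v2 renamed. *)
Definition swap_step (n m : nat) (G H : {set 'I_n * 'I_m}) : bool :=
  [exists u1 : 'I_n, exists u2 : 'I_n, exists v1 : 'I_m, exists v2 : 'I_m,
    [&& u1 != u2, v1 != v2, (u1, v1) \in G, (u2, v2) \in G,
        (u1, v2) \notin G, (u2, v1) \notin G &
        H == (((G :\ (u1, v1)) :\ (u2, v2)) :|: [set (u1, v2); (u2, v1)])]].

Definition swap_prob (n m : nat) : R :=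
  Rinv (Rmult (Rmult 2 (INR (binomial n 2))) (INR (binomial m 2))).

Definition offdiag (n m : nat) (G H : {set 'I_n * 'I_m}) : R :=
  if (H != G) && swap_step G H then swap_prob n m else R0.

Definition swapP (n m : nat) (G H : {set 'I_n * 'I_m}) : R :=
  if H == G then Rminus R1 (\big[Rplus/R0]_(K : {set 'I_n * 'I_m} | K != G) offdiag G K)
  else offdiag G H.

Fixpoint swapPt (n m : nat) (du : 'I_n -> nat) (dv : 'I_m -> nat) (t : nat)
  (G H : {set 'I_n * 'I_m}) : R :=
  match t with
  | 0 => if G == H then R1 else R0
  | t'.+1 => \big[Rplus/R0]_(K : {set 'I_n * 'I_m} | realizes du dv K)
               Rmult (swapPt du dv t' G K) (swapP K H)
  end.

Definition unif (n m : nat) (du : 'I_n -> nat) (dv : 'I_m -> nat) : R :=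
  Rinv (INR #|[set K : {set 'I_n * 'I_m} | realizes du dv K]|).

Definition tv_dist (n m : nat) (du : 'I_n -> nat) (dv : 'I_m -> nat) (t : nat)
  (G : {set 'I_n * 'I_m}) : R :=
  Rmult (Rinv 2) (\big[Rplus/R0]_(H : {set 'I_n * 'I_m} | realizes du dv H)
          Rabs (Rminus (swapPt du dv t G H) (unif du dv))).

(* Main.v *)
(* Spectral gap by canonical paths.  A realization is lifted to a perfect
   matching (a permutation) of Tutte's gadget.  For two permutations s1, s2, the
   cycles of s1^-1 s2 are swapped one after the other by transpositions; the
   walk stays among permutations with at most one forbidden entry, and recording
   the complementary permutation makes each of its moves injective, so that
   every permutation is visited by few pairs (s1, s2).
   A permutation with one forbidden entry projects to a graph whose degrees are
   off by one at two vertices.  The hypothesis on the degrees makes the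
   alternating path that repairs it short: breadth-first layers which fail to
   reach the other vertex violate the inequality by double counting.  Hence this
   graph is within a bounded number of flips of a realization, and two
   realizations that differ in boundedly many pairs are joined by boundedly many
   swaps.  Pushing the walks down gives a Poincare inequality for the swap chain
   with a polynomial constant. *)

Require Import Defs.
From Stdlib Require Import Reals ZArith Lia Lra.
From mathcomp Require Import all_boot.

Set Implicit Arguments.
Unset Strict Implicit.
Unset Printing Implicit Defensive.

(** * Elementary estimates *)

(** The detour through permutations meets the main obstacle of canonical paths between bipartite
    graphs: the symmetric difference of two realizations splits into alternating cycles in many
    ways, whereas two permutations determine their cycles. The price is that a realization has many
    lifts. Their number is never computed: with [Gam] the number of relabelings, a realization has
    at least [Gam] perfect lifts, a graph has at most [Gam] times a polynomial near-perfect ones,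
    and [Gam ^ 2] cancels in the comparison. Congestion is not counted either: sums of squares of an
    arbitrary function are compared, and an injective encoding turns a sum over pairs into a sum
    over codes. Only one alternative of the maximum in the hypothesis is treated directly;
    complementing the graph gives the other. Laziness of the chain lets the Poincare inequality
    alone yield contraction in mean square. The constants go back to a search of radius 6, at two
    flips per unit of radius. *)

Section RealTime.
Local Open Scope R_scope.

Lemma exp_mul_nat (x : R) (k : nat) : exp (INR k * x) = (exp x) ^ k.
Proof.
elim: k => [|k IH]; first by rewrite Rmult_0_l exp_0.
by rewrite S_INR Rmult_plus_distr_r Rmult_1_l exp_plus IH /= Rmult_comm.
Qed.

Lemma two_pow_le_exp (k : nat) : 2 ^ k <= exp (INR k).
Proof.
rewrite -[INR k]Rmult_1_r exp_mul_nat; apply: pow_incr.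
by have := exp_ineq1_le 1; lra.
Qed.

Lemma ln_Rinv_gt0 (eps : R) : 0 < eps -> eps < 1 -> 0 < ln (/ eps).
Proof.
move=> e0 e1; rewrite -ln_1; apply: ln_increasing; first lra.
by rewrite -[X in X < _]Rinv_1; apply: Rinv_lt_contravar; lra.
Qed.

(** [K] stands for the number of states and [K * (1 - / rho) ^ t] for a squared distance, whence
    [eps ^ 2] and the factor 2. Since [1 - / rho <= exp (- / rho)], any [t] of at least
    [rho * (a + 2 * ln (/ eps))] works; rounding up costs at most 1. *)
Lemma exists_mixing_time (rho K a eps : R) :
  1 <= rho -> 0 <= K -> K <= exp a -> 0 <= a -> 0 < eps -> eps < 1 ->
  exists t : nat, INR t <= rho * (a + 2 * ln (/ eps)) + 1 /\
    K * (1 - / rho) ^ t <= eps ^ 2.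
Proof.
move=> rho1 K0 Ka a0 e0 e1.
have L0 := ln_Rinv_gt0 e0 e1.
set y := rho * (a + 2 * ln (/ eps)).
have y0 : 0 <= y by apply: Rmult_le_pos; lra.
have [up1 up2] := archimed y.
exists (Z.to_nat (up y)).
have tE : INR (Z.to_nat (up y)) = IZR (up y).
  rewrite INR_IZR_INZ Z2Nat.id //; apply: le_IZR; lra.
split; first by rewrite tE; lra.
have r0 : 0 <= 1 - / rho.
  have : / rho <= / 1 by apply: Rinv_le_contravar; lra.
  by rewrite Rinv_1; lra.
have H : (1 - / rho) ^ Z.to_nat (up y) <= exp (- a) * eps ^ 2.
  apply: (Rle_trans _ (exp (- / rho) ^ Z.to_nat (up y))).
    by apply: pow_incr; split=> //; have := exp_ineq1_le (- / rho); lra.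
  rewrite -exp_mul_nat tE.
  have -> : eps ^ 2 = exp (- (2 * ln (/ eps))).
    rewrite ln_Rinv // -[X in X ^ 2](exp_ln eps) // -exp_mul_nat; congr exp.
    by rewrite /=; ring.
  rewrite -exp_plus.
  have le : IZR (up y) * - / rho <= - a + - (2 * ln (/ eps)).
    have -> : - a + - (2 * ln (/ eps)) = y * - / rho by rewrite /y; field; lra.
    have i0 : 0 < / rho by apply: Rinv_0_lt_compat; lra.
    by have := Rmult_le_compat_r (/ rho) y (IZR (up y)) (Rlt_le _ _ i0) (Rlt_le _ _ up1); lra.
  by case: le => [/exp_increasing|->]; lra.
have E0 := exp_pos (- a).
apply: (Rle_trans _ (exp a * (exp (- a) * eps ^ 2))).
  by apply: Rmult_le_compat => //; apply: pow_le.
rewrite -Rmult_assoc -exp_plus Rplus_opp_r exp_0; lra.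
Qed.

End RealTime.

(** The main hypothesis says [(a - c) * (p - y) >= c * y]. As [a > c], raising the second factor by
    one makes the inequality strict, which is what contradicts the degree condition. *)
Lemma growth_Z (a p y c x w : Z) :
  (0 < a)%Z -> (0 <= p)%Z -> (0 <= c)%Z -> (0 < y)%Z ->
  (c * p + a * y <= a * p)%Z -> (a - c <= x)%Z -> (p - y + 1 <= w)%Z ->
  (c * y < x * w)%Z.
Proof.
move=> a0 p0 c0 y0 H X W.
have ac : (c < a)%Z.
  case: (Z.lt_ge_cases c a) => // ca; exfalso.
  have : (a * p <= c * p)%Z by apply: Z.mul_le_mono_nonneg_r.
  have : (0 < a * y)%Z by apply: Z.mul_pos_pos.
  by clear -H; lia.
have py : (y <= p)%Z.
  case: (Z.lt_ge_cases p y) => // py; exfalso.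
  have cp : (0 <= c * p)%Z by apply: Z.mul_nonneg_nonneg.
  have : (a * p < a * y)%Z by apply/(Z.mul_lt_mono_pos_l a p y a0).
  by clear -H cp; lia.
have : ((a - c) * (p - y + 1) <= x * w)%Z by apply: Z.mul_le_mono_nonneg; lia.
have -> : ((a - c) * (p - y + 1) = (a * p - c * p - a * y) + c * y + (a - c))%Z by ring.
by clear -H ac; lia.
Qed.

From mathcomp Require Import all_order all_algebra all_fingroup.
From mathcomp Require Import Rstruct.
From mathcomp Require Import zify ring lra.
Import Order.TTheory GRing.Theory Num.Theory.
(* [ssrint] takes over the key Z *)
Delimit Scope Z_scope with Z.

(** * Sums over finite families *)

Section SumLemmas.
Local Open Scope ring_scope.
Variable F : realFieldType.

Lemma sqr_sum_le (k : nat) (a : nat -> F) :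
  (\sum_(i < k) a i) ^+ 2 <= k%:R * \sum_(i < k) a i ^+ 2.
Proof.
elim: k => [|k IH]; first by rewrite !big_ord0 expr0n mulr0.
rewrite !big_ord_recr /=; set S := \sum_(i < k) a i in IH *.
set Q := \sum_(i < k) a i ^+ 2 in IH *.
have Q0 : 0 <= Q by apply: sumr_ge0 => i _; apply: sqr_ge0.
case: k => [|k] in S Q IH Q0 *.
  by rewrite /S /Q !big_ord0 !add0r mul1r.
have k0 : 0 < k.+1%:R :> F by rewrite ltr0n.
rewrite -[k.+2]addn1 natrD; move: (k.+1%:R) k0 IH => K K0 IH.
have H : K * (2 * S * a k.+1) <= K * (K * a k.+1 ^+ 2 + Q).
  have := sqr_ge0 (K * a k.+1 - S); nra.
move: H; rewrite ler_pM2l // => H; nra.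
Qed.

Lemma telescope_sqr_le (k : nat) (z : nat -> F) :
  (z 0%N - z k) ^+ 2 <= k%:R * \sum_(i < k) (z i - z i.+1) ^+ 2.
Proof.
have -> : z 0%N - z k = \sum_(i < k) (z i - z i.+1).
  elim: k => [|k IH]; first by rewrite big_ord0 subrr.
  by rewrite big_ord_recr /= -IH; ring.
exact: (sqr_sum_le k (fun i => z i - z i.+1)).
Qed.

(** [f] is an injective code; every encoding argument below is an instance. *)
Lemma sum_inj_le (I J : finType) (A : pred I) (B : pred J) (f : I -> J) (h : J -> F) :
  {in A &, injective f} -> (forall i, A i -> B (f i)) -> (forall j, B j -> 0 <= h j) ->
  \sum_(i | A i) h (f i) <= \sum_(j | B j) h j.
Proof.
move=> finj fAB h0.
rewrite -(big_imset h finj) /=.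
rewrite [leRHS](bigID (fun j => j \in f @: A)) /=.
rewrite (eq_bigl (fun j => B j && (j \in f @: A))); last first.
  move=> j; case: imsetP => [[i Ai ->]|]; last by rewrite andbF.
  by rewrite andbT; apply/esym/fAB.
by rewrite lerDl; apply: sumr_ge0 => j /andP[Bj _]; apply: h0.
Qed.

End SumLemmas.

(** * Walks between permutations *)

Section PermPairs.
Local Open Scope ring_scope.
Variable T : finType.
Implicit Types (s L : {perm T}) (st : {perm T} * {perm T}) (x y z : T).

Lemma eq_perm_pair st st' : st.1 =1 st'.1 -> st.2 =1 st'.2 -> st = st'.
Proof. by case: st st' => [s L] [s' L'] /= /permP-> /permP->. Qed.

(** Products act from left to right, so this maps [x] to [st.1^-1 (st.2 x)]. Its cycles are the
    alternating cycles of the two matchings. *)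
Definition nxt st : {perm T} := (st.2 * st.1^-1)%g.

Lemma nxtE st x : st.1 (nxt st x) = st.2 x.
Proof. by rewrite /nxt permM permKV. Qed.

Lemma porbit_perm1 (p : {perm T}) x : porbit p (p x) = porbit p x.
Proof. exact: (porbit_perm p 1 x). Qed.

Lemma porbit_sub (p q : {perm T}) y :
  (forall x, q x \in porbit p x) -> porbit q y \subset porbit p y.
Proof.
move=> H; apply/subsetP => z /porbitP[i ->].
elim: i => [|i IH]; first by rewrite expg0 perm1 porbit_id.
rewrite expgSr permM; move: IH; rewrite -eq_porbit_mem => /eqP <-.
exact: H.
Qed.

Lemma perm_porbit_mem (p : {perm T}) x y : (p y \in porbit p x) = (y \in porbit p x).
Proof. by rewrite -!eq_porbit_mem porbit_perm1. Qed.

Lemma permV_porbit_mem (p : {perm T}) x y : (p^-1%g y \in porbit p x) = (y \in porbit p x).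
Proof. by rewrite -{2}[y](permKV p) perm_porbit_mem. Qed.

Lemma porbit_norm (p : {perm T}) x : p \in 'N(porbit p x | 'P)%g.
Proof.
rewrite inE in_setT /= inE; apply/subsetP => y yx.
by rewrite inE /= /aperm perm_porbit_mem.
Qed.

(** Both permutations map an orbit of [nxt st] onto the same set, so they can be exchanged there.
    Multiplying by the restriction of [nxt st] gives permutations without a separate proof of
    injectivity. *)
Definition swap_orbit st (x : T) : {perm T} * {perm T} :=
  let c := restr_perm (porbit (nxt st) x) (nxt st) in ((c * st.1)%g, (c^-1 * st.2)%g).

Lemma swap_orbit1E st x y :
  (swap_orbit st x).1 y = if y \in porbit (nxt st) x then st.2 y else st.1 y.
Proof.
rewrite /swap_orbit /= permM; case: ifP => yx.
  by rewrite restr_permE ?porbit_norm // nxtE.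
by rewrite (out_perm (restr_perm_on _ _)) ?yx.
Qed.

Lemma swap_orbit2E st x y :
  (swap_orbit st x).2 y = if y \in porbit (nxt st) x then st.1 y else st.2 y.
Proof.
rewrite /swap_orbit /= permM; set c := restr_perm _ _; case: ifP => yx.
  have cE : c ((nxt st)^-1%g y) = y.
    by rewrite restr_permE ?porbit_norm ?permV_porbit_mem // permKV.
  by rewrite -{1}cE permK -nxtE permKV.
have cy : c y = y by rewrite (out_perm (restr_perm_on _ _)) ?yx.
by rewrite -{1}cy permK.
Qed.

Lemma nxt_swap_orbit st x y :
  nxt (swap_orbit st x) y = if y \in porbit (nxt st) x then (nxt st)^-1%g y else nxt st y.
Proof.
apply: (@perm_inj _ (swap_orbit st x).1); rewrite nxtE swap_orbit1E swap_orbit2E.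
case: ifP => yx.
  by rewrite permV_porbit_mem yx -nxtE permKV.
by rewrite perm_porbit_mem yx nxtE.
Qed.

(** The exchange inverts [nxt] on one orbit and keeps it elsewhere, so the partition into orbits
    persists, and with it the choice of representatives. *)
Lemma porbit_swap_orbit st x y : porbit (nxt (swap_orbit st x)) y = porbit (nxt st) y.
Proof.
apply/eqP; rewrite eqEsubset; apply/andP; split; apply: porbit_sub => z.
  rewrite nxt_swap_orbit; case: ifP => _; first by rewrite permV_porbit_mem porbit_id.
  by rewrite perm_porbit_mem porbit_id.
case zx: (z \in porbit (nxt st) x); last first.
  by rewrite -{1}[nxt st z](_ : nxt (swap_orbit st x) z = _) ?perm_porbit_mem ?porbit_id //
    nxt_swap_orbit zx.
rewrite -perm_porbit_mem nxt_swap_orbit perm_porbit_mem zx permK.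
exact: porbit_id.
Qed.

(** [pick] depends on the orbit alone and so names one point of it. Running through all points of
    [T] treats each cycle exactly once, without enumerating cycles. *)
Definition orbit_rep (p : {perm T}) x : bool := [pick z in porbit p x] == Some x.

Definition swap_at st x := if orbit_rep (nxt st) x then swap_orbit st x else st.

Lemma porbit_swap_at st x y : porbit (nxt (swap_at st x)) y = porbit (nxt st) y.
Proof. by rewrite /swap_at; case: ifP => // _; apply: porbit_swap_orbit. Qed.

Lemma swap_atK x : involutive (swap_at^~ x).
Proof.
move=> st; have oE : orbit_rep (nxt (swap_at st x)) x = orbit_rep (nxt st) x.
  by rewrite /orbit_rep porbit_swap_at.
rewrite {1}/swap_at oE /swap_at; case: (orbit_rep (nxt st) x) => //.
apply: eq_perm_pair => y.
  rewrite swap_orbit1E porbit_swap_orbit swap_orbit1E swap_orbit2E.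
  by case: (y \in _).
rewrite swap_orbit2E porbit_swap_orbit swap_orbit1E swap_orbit2E.
by case: (y \in _).
Qed.

Definition swaps_at st (xs : seq T) := foldl swap_at st xs.

(** Each stage is an involution, so the pair reached determines the initial pair. This allows one
    stage to be summed over all pairs of perfect permutations. *)
Lemma swaps_at_inj xs : injective (swaps_at^~ xs).
Proof.
elim: xs => [|x xs IH] st st' //= /IH H.
by rewrite -[st](swap_atK x) H swap_atK.
Qed.

(** [b y] says that the orbit of [y] has its representative in [xs]. Distinctness matters: a second
    visit would undo the exchange. *)
Lemma swaps_atE xs st : uniq xs ->
  let b y := [pick z in porbit (nxt st) y] \in map Some xs in
  (forall y, (swaps_at st xs).1 y = if b y then st.2 y else st.1 y) /\
  (forall y, (swaps_at st xs).2 y = if b y then st.1 y else st.2 y).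
Proof.
elim: xs st => [|x xs IH] st //= /andP[xNxs uxs].
have [IH1 IH2] := IH (swap_at st x) uxs.
have key y : (y \in porbit (nxt st) x) && orbit_rep (nxt st) x =
             ([pick z in porbit (nxt st) y] == Some x).
  apply/andP/eqP => [[]|yx].
    by rewrite -eq_porbit_mem => /eqP-> /eqP.
  have : x \in porbit (nxt st) y by case: pickP yx => // z zy [<-].
  rewrite porbit_sym => xy; split => //.
  by move: xy yx; rewrite -eq_porbit_mem /orbit_rep => /eqP -> ->.
have disj y : [pick z in porbit (nxt st) y] == Some x ->
    [pick z in porbit (nxt st) y] \in map Some xs = false.
  move/eqP->; apply/negbTE/negP => /mapP[z zxs [xz]].
  by rewrite xz zxs in xNxs.
split=> y.
  rewrite IH1 porbit_swap_at inE -key /swap_at.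
  case: (boolP (orbit_rep (nxt st) x)) (disj y) (key y) => [_|_] /=; rewrite ?andbT ?andbF.
    rewrite swap_orbit1E swap_orbit2E; case: (y \in porbit (nxt st) x) => //= d k.
    by rewrite d // -k.
  by [].
rewrite IH2 porbit_swap_at inE -key /swap_at.
case: (boolP (orbit_rep (nxt st) x)) (disj y) (key y) => [_|_] /=; rewrite ?andbT ?andbF.
  rewrite swap_orbit1E swap_orbit2E; case: (y \in porbit (nxt st) x) => //= d k.
  by rewrite d // -k.
by [].
Qed.

Lemma swaps_at_all st : swaps_at st (enum T) = (st.2, st.1).
Proof.
have [H1 H2] := swaps_atE st (enum_uniq T).
have bT y : [pick z in porbit (nxt st) y] \in map Some (enum T).
  case: pickP => [z _|/(_ y)]; first by rewrite map_f ?mem_enum.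
  by rewrite porbit_id.
apply: eq_perm_pair => y.
  by rewrite H1 bT.
by rewrite H2 bT.
Qed.

End PermPairs.

(** * Walking along one cycle by transpositions *)

Section OrbitWalk.
Local Open Scope ring_scope.
Variable T : finType.
Implicit Types (st : {perm T} * {perm T}) (x y z l : T).

(* A state (s, L, x, l): the walk from s has reached x, L is the complementary
   permutation (away from x and l it takes the value among s1, s2 that s does not),
   and l, the last point of the cycle, carries the forbidden entry of L.  The
   previous point is recovered as s^-1 (L l), whence walk_step_inj. *)
Definition walk_state : Type := ({perm T} * {perm T}) * (T * T).

Definition walk_next (w : walk_state) : T := (w.1.1)^-1%g (w.1.2 w.2.1).

Definition walk_step (w : walk_state) : walk_state :=
  let x := w.2.1 in let l := w.2.2 in
  ((tperm x (walk_next w) * w.1.1, tperm x l * w.1.2)%g, (walk_next w, l)).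

Lemma walk_step_inj : injective walk_step.
Proof.
move=> [[s L] [x l]] [[s' L'] [x' l']]; rewrite /walk_step /walk_next /=.
set z := s^-1%g (L x); set z' := s'^-1%g (L' x') => -[E1 E2 E3 E4].
rewrite -{}E4 in E2 *; have xx : x = x'.
  apply: (@perm_inj _ (tperm x z * s)%g); rewrite {2}E1 !permM !tpermL.
  by rewrite /z /z' !permKV; have := congr1 (fun p : {perm T} => p l) E2; rewrite !permM !tpermR.
rewrite -{}xx -{}E3 in E1 E2 *.
by rewrite (mulgI _ _ _ E1) (mulgI _ _ _ E2).
Qed.

Definition walk (k : nat) st x : walk_state :=
  iter k walk_step (st, (x, (nxt st)^-1%g x)).

Lemma walk_inj k x : injective (fun st => walk k st x).
Proof.
move=> st st' H; have: injective (iter k walk_step).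
  by elim: k {H} => [|k IH] u v //= /walk_step_inj /IH.
by move=> /(_ _ _ H) [].
Qed.

Section WalkInvariant.
Variables (st : {perm T} * {perm T}) (s : T).
Let p := nxt st.
Let len := #|porbit p s|.
Let l := p^-1%g s.

Lemma last_traject : iter len.-1 p s = l.
Proof.
apply: (@perm_inj _ p); rewrite permKV -iterS prednK ?iter_porbit //.
by apply/card_gt0P; exists s; apply: porbit_id.
Qed.

Lemma iter_notin_traject k : (k < len)%N -> iter k p s \notin traject p s k.
Proof.
move=> klen; have : uniq (traject p s k.+1).
  by have := take_uniq k.+1 (uniq_traject_porbit p s); rewrite take_traject.
by rewrite trajectSr rcons_uniq => /andP[].
Qed.

Lemma traject_subl k : (k < len)%N -> l \notin traject p s k.
Proof.
move=> klen; have len0 : (0 < len)%N by apply: leq_ltn_trans klen.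
have := @iter_notin_traject len.-1; rewrite ltn_predL len0 last_traject => /(_ isT).
apply: contra => /trajectP[i ik ->]; apply/trajectP; exists i => //.
by apply: leq_trans ik _; rewrite -ltnS prednK.
Qed.

(** Each transposition hands the value [st.1 s] on to the next point of the cycle, so the current
    point is the only place where the first permutation may be forbidden; in the second one the
    displaced value always sits at [l]. *)
Lemma walkE k : (k < len)%N ->
  [/\ (walk k st s).2 = (iter k p s, l),
   forall y, (walk k st s).1.1 y = if y \in traject p s k then st.2 y
             else if y == iter k p s then st.1 s else st.1 y
   & forall y, (walk k st s).1.2 y = if y \in traject p s k then st.1 y
             else if y == l then st.1 (iter k p s) else st.2 y].
Proof.
elim: k => [|k IH] klen.
  split=> //= y; first by case: eqP => [->|].
  by case: eqP => [->|//]; rewrite -nxtE permKV.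
have klen' := ltnW klen; have [] := IH klen'; rewrite trajectSr.
have -> : walk k.+1 st s = walk_step (walk k st s) by [].
case: (walk k st s) => [[sk Lk] [x l']] /= [-> ->] {x l'} sE LE.
set x := iter k p s in sE LE *.
have xl : x != l.
  apply/eqP => E; move: (iter_notin_traject klen); rewrite /= -/x E permKV.
  by rewrite inE eqxx.
have xN := iter_notin_traject klen'; rewrite -/x in xN.
have xN' := iter_notin_traject klen; rewrite -/x trajectSr mem_rcons inE negb_or -/x in xN'.
have lN := traject_subl klen'.
have [xx' pxN] := andP xN'; rewrite /= -/x in xx' pxN.
have nE : walk_next (sk, Lk, (x, l)) = p x.
  rewrite /walk_next /= LE (negbTE xN) (negbTE xl); apply: (@perm_inj _ sk).
  by rewrite permKV sE (negbTE pxN) (negbTE xx') nxtE.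
split=> [|y|y]; rewrite ?mem_rcons /walk_step /= ?nE //.
  rewrite permM inE -/x; case: tpermP => [->|->|/eqP yx /eqP ypx].
  - by rewrite eqxx sE (negbTE pxN) (negbTE xx') nxtE.
  - by rewrite (negbTE xx') (negbTE pxN) eqxx sE (negbTE xN) eqxx.
  - by rewrite (negbTE yx) (negbTE ypx) sE (negbTE yx).
rewrite permM inE -/x; case: tpermP => [->|->|/eqP yx /eqP yl].
- by rewrite eqxx LE (negbTE lN) eqxx.
- by rewrite eq_sym (negbTE xl) (negbTE lN) eqxx LE (negbTE xN) (negbTE xl) -/p nxtE.
- by rewrite (negbTE yx) (negbTE yl) LE (negbTE yl).
Qed.

(** At the last point the value handed on is the right one, [st.1 s = st.2 l], so the defect
    disappears. *)
Lemma walk_last : (walk len.-1 st s).1.1 = (swap_orbit st s).1.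
Proof.
have len0 : (0 < len)%N by apply/card_gt0P; exists s; apply: porbit_id.
have [|_ sE _] := @walkE len.-1; first by rewrite ltn_predL.
apply/permP => y; rewrite sE swap_orbit1E -/p porbit_traject -/len.
rewrite -{3}(prednK len0) trajectSr mem_rcons inE orbC; case: (y \in _) => //=.
by case: eqP => // ->; rewrite last_traject -nxtE permKV.
Qed.

End WalkInvariant.
End OrbitWalk.

(** * Energy along the walks *)

Section Allowed.
Local Open Scope ring_scope.
Variables (T : finType) (A : rel T).

Definition perfect (s : {perm T}) := [forall x, A x (s x)].
Definition near_perfect (s : {perm T}) := [exists x0, forall x, (x != x0) ==> A x (s x)].

Lemma perfect_swap_at st x : perfect st.1 && perfect st.2 ->
  perfect (swap_at st x).1 && perfect (swap_at st x).2.
Proof.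
move=> /andP[/forallP p1 /forallP p2]; rewrite /swap_at; case: ifP => _; last first.
  by apply/andP; split; apply/forallP.
by apply/andP; split; apply/forallP => y; rewrite ?swap_orbit1E ?swap_orbit2E; case: ifP.
Qed.

Lemma perfect_swaps_at st xs : perfect st.1 && perfect st.2 ->
  perfect (swaps_at st xs).1 && perfect (swaps_at st xs).2.
Proof. by elim: xs st => //= x xs IH st H; apply/IH/perfect_swap_at. Qed.

Lemma near_perfect_walk st s k : perfect st.1 && perfect st.2 ->
  (k < #|porbit (nxt st) s|)%N ->
  near_perfect (walk k st s).1.1 && near_perfect (walk k st s).1.2.
Proof.
move=> /andP[/forallP p1 /forallP p2] klen; have [_ sE LE] := walkE klen.
apply/andP; split; apply/existsP.
  exists (iter k (nxt st) s); apply/forallP => y; apply/implyP => /negbTE yx.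
  by rewrite sE yx; case: ifP.
exists ((nxt st)^-1%g s); apply/forallP => y; apply/implyP => /negbTE yx.
by rewrite LE yx; case: ifP.
Qed.

Variable F : realFieldType.
Variable g : {perm T} -> F.

Let N := #|T|.

Definition near_energy : F :=
  \sum_(s | near_perfect s) \sum_(a : T) \sum_(b : T | near_perfect (tperm a b * s)%g)
     (g s - g (tperm a b * s)%g) ^+ 2.

Definition good_step (w : walk_state T) :=
  [&& near_perfect w.1.1, near_perfect w.1.2 & near_perfect (walk_step w).1.1].

(** In the code of a step, [(L, l)] takes [N * #|near_perfect|] values; what remains is a
    permutation with a transposition, a term of [near_energy]. *)
Lemma walk_energy :
  \sum_(w | good_step w) (g w.1.1 - g (walk_step w).1.1) ^+ 2
    <= (N * #|near_perfect|)%:R * near_energy.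
Proof.
pose f (w : walk_state T) := ((w.1.2, w.2.2), (w.1.1, (w.2.1, walk_next w))).
pose h (j : ({perm T} * T) * ({perm T} * (T * T))) :=
  (g j.2.1 - g (tperm j.2.2.1 j.2.2.2 * j.2.1)%g) ^+ 2.
pose B (j : ({perm T} * T) * ({perm T} * (T * T))) :=
  near_perfect j.1.1 &&
  (near_perfect j.2.1 && near_perfect (tperm j.2.2.1 j.2.2.2 * j.2.1)%g).
apply: (@le_trans _ _ (\sum_(j | B j) h j)).
  apply: (sum_inj_le (f := f)) => [|w /and3P[w1 w2 w3]|j _].
  - by move=> [[s L] [x l]] [[s' L'] [x' l']] _ _ [-> -> -> ->].
  - by rewrite /B /= w1 w2.
  - exact: sqr_ge0.
rewrite /B /h -(pair_big_dep (fun p : {perm T} * T => near_perfect p.1)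
  (fun _ q => near_perfect q.1 && near_perfect (tperm q.2.1 q.2.2 * q.1)%g)
  (fun _ q => (g q.1 - g (tperm q.2.1 q.2.2 * q.1)%g) ^+ 2)) /=.
rewrite sumr_const.
have -> : #|[pred p : {perm T} * T | near_perfect p.1]| = (N * #|near_perfect|)%N.
  rewrite mulnC -cardX; apply: eq_card => -[s t]; by rewrite !inE andbT.
rewrite -[X in X <= _]mulr_natl ler_wpM2l ?ler0n //.
rewrite -(pair_big_dep near_perfect
  (fun s q => near_perfect (tperm q.1 q.2 * s)%g)
  (fun s q => (g s - g (tperm q.1 q.2 * s)%g) ^+ 2)) /=.
rewrite le_eqVlt; apply/orP; left; apply/eqP; apply: eq_bigr => s _.
by rewrite -(pair_big_dep xpredT (fun a b => near_perfect (tperm a b * s)%g)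
  (fun a b => (g s - g (tperm a b * s)%g) ^+ 2)).
Qed.

(** Of the three factors [N], one is the Cauchy-Schwarz loss over a walk, one the number of step
    indices, one the choice of [l]. *)
Lemma swap_at_energy x :
  \sum_(st | perfect st.1 && perfect st.2) (g st.1 - g (swap_at st x).1) ^+ 2
    <= (N ^ 3 * #|near_perfect|)%:R * near_energy.
Proof.
pose len (st : {perm T} * {perm T}) := #|porbit (nxt st) x|.
have len0 st : (0 < len st)%N by apply/card_gt0P; exists x; apply: porbit_id.
have lenN st : (len st <= N)%N by apply: max_card.
pose e k (st : {perm T} * {perm T}) := (g (walk k st x).1.1 - g (walk k.+1 st x).1.1) ^+ 2.
apply: (@le_trans _ _ (\sum_(st | perfect st.1 && perfect st.2)
   N%:R * \sum_(k < N | (k.+1 < len st)%N) e k st)).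
  apply: ler_sum => st _; rewrite /swap_at.
  have s0 : 0 <= \sum_(k < N | (k.+1 < len st)%N) e k st.
    by apply: sumr_ge0 => k _; apply: sqr_ge0.
  case: ifP => _; last by rewrite subrr expr0n mulr_ge0 ?ler0n.
  rewrite -walk_last; have := telescope_sqr_le (len st).-1 (fun k => g (walk k st x).1.1).
  move=> /le_trans; apply.
  have -> : \sum_(k < N | (k.+1 < len st)%N) e k st = \sum_(k < (len st).-1) e k st.
    rewrite (big_ord_widen N (fun k => e k st)); last exact: leq_trans (leq_pred _) _.
    by apply: eq_bigl => k; rewrite ltn_predRL.
  apply: ler_pM; rewrite ?ler0n ?ler_nat //; last exact: leq_trans (leq_pred _) _.
  by apply: sumr_ge0 => k _; apply: sqr_ge0.
rewrite -mulr_sumr.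
under eq_bigr => st _ do rewrite big_mkcond.
rewrite exchange_big /=.
apply: (@le_trans _ _ (N%:R * \sum_(k < N) ((N * #|near_perfect|)%:R * near_energy))).
  apply: ler_wpM2l; rewrite ?ler0n //; apply: ler_sum => k _.
  rewrite -big_mkcondr /=; apply: le_trans walk_energy.
  apply: (sum_inj_le (f := fun st => walk k st x)
     (h := fun w => (g w.1.1 - g (walk_step w).1.1) ^+ 2)).
  - by move=> st st' _ _; apply: walk_inj.
  - move=> st /andP[pst klen]; rewrite /good_step.
    have /andP[-> ->] := near_perfect_walk pst (ltnW klen).
    by have /andP[-> _] := near_perfect_walk pst klen.
  - by move=> w _; apply: sqr_ge0.
rewrite sumr_const card_ord -(mulr_natl (_ * near_energy)) !mulrA -!natrM.
by rewrite !expnS expn0 muln1 !mulnA lexx.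
Qed.

(** The swap stages lead the first component from [s] to [s']. Telescoping over them costs a factor
    [N] for Cauchy-Schwarz and another for the number of stages. *)
Lemma perfect_pairs_energy :
  \sum_(s | perfect s) \sum_(s' | perfect s') (g s - g s') ^+ 2
    <= (N ^ 5 * #|near_perfect|)%:R * near_energy.
Proof.
rewrite pair_big_dep /=.
pose z i (st : {perm T} * {perm T}) := swaps_at st (take i (enum T)).
apply: (@le_trans _ _ (\sum_(st | perfect st.1 && perfect st.2)
   N%:R * \sum_(i < N) (g (z i st).1 - g (z i.+1 st).1) ^+ 2)).
  apply: ler_sum => st _; have := telescope_sqr_le N (fun i => g (z i st).1).
  by rewrite {2}/z take_oversize -?cardE ?swaps_at_all ?/z ?take0.
rewrite -mulr_sumr exchange_big /=.
apply: (@le_trans _ _ (N%:R * \sum_(i < N) ((N ^ 3 * #|near_perfect|)%:R * near_energy))).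
  apply: ler_wpM2l; rewrite ?ler0n //; apply: ler_sum => i _.
  (* Only a default for [nth]; the index [i] shows that [T] is inhabited. *)
  have x0 : T by apply: (enum_val i).
  apply: le_trans (swap_at_energy (nth x0 (enum T) i)).
  have zS st : z i.+1 st = swap_at (z i st) (nth x0 (enum T) i).
    by rewrite /z /swaps_at (take_nth x0) -?cardE // foldl_rcons.
  under eq_bigr => st _ do rewrite zS.
  apply: (sum_inj_le (f := z i) (h := fun st => (g st.1 - g (swap_at st (nth x0 (enum T) i)).1) ^+ 2)).
  - by move=> st st' _ _; apply: swaps_at_inj.
  - by move=> st; apply: perfect_swaps_at.
  - by move=> w _; apply: sqr_ge0.
rewrite sumr_const card_ord -(mulr_natl (_ * near_energy)) !mulrA -!natrM.
by rewrite !expnS expn0 muln1 !mulnA lexx.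
Qed.

End Allowed.

(** * Swaps *)

Section Swaps.
Variables n m : nat.
Implicit Types (X Y Z H K : {set 'I_n * 'I_m}) (u : 'I_n) (v : 'I_m).

Definition sdiff X Y := (X :\: Y) :|: (Y :\: X).

Lemma in_sdiff X Y e : (e \in sdiff X Y) = ((e \in X) != (e \in Y)).
Proof. by rewrite !inE; case: (e \in X); case: (e \in Y). Qed.

Lemma sdiffC X Y : sdiff X Y = sdiff Y X.
Proof. by apply/setP => e; rewrite !in_sdiff eq_sym. Qed.

Lemma sdiff_triangle X Y Z : #|sdiff X Z| <= #|sdiff X Y| + #|sdiff Y Z|.
Proof.
apply: leq_trans (leq_card_setU _ _); apply: subset_leq_card; apply/subsetP => e.
by rewrite in_setU !in_sdiff; case: (_ \in X); case: (_ \in Y); case: (_ \in Z).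
Qed.

Lemma sdiff_eq0 X Y : (#|sdiff X Y| == 0) = (X == Y).
Proof.
rewrite cards_eq0; apply/eqP/eqP => [/setP H|->]; last by rewrite /sdiff setDv setU0.
by apply/setP => e; have := H e; rewrite in_sdiff inE => /negbFE/eqP.
Qed.

Definition same_deg X Y := (degU X =1 degU Y) /\ (degV X =1 degV Y).

Definition swap_set X u1 u2 v1 v2 :=
  ((X :\ (u1, v1)) :\ (u2, v2)) :|: [set (u1, v2); (u2, v1)].

Lemma card_exchange (T : finType) (S : {set T}) a b :
  a \in S -> b \notin S -> #|b |: (S :\ a)| = #|S|.
Proof. by move=> aS bS; rewrite cardsU1 !inE (negbTE bS) andbF (cardsD1 a S) aS. Qed.

Lemma swap_stepP X Z : reflect
  (exists u1 u2 v1 v2, [/\ u1 != u2, v1 != v2,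
     [/\ (u1, v1) \in X, (u2, v2) \in X, (u1, v2) \notin X & (u2, v1) \notin X]
     & Z = swap_set X u1 u2 v1 v2])
  (swap_step X Z).
Proof.
apply: (iffP existsP) => [[u1 /existsP[u2 /existsP[v1 /existsP[v2]]]]|].
  by case/and5P=> ? ? ? ? /and3P[? ? /eqP ?]; exists u1, u2, v1, v2.
move=> [u1 [u2 [v1 [v2 [H1 H2 [H3 H4 H5 H6] ->]]]]].
exists u1; apply/existsP; exists u2; apply/existsP; exists v1; apply/existsP; exists v2.
by rewrite H1 H2 H3 H4 H5 H6 /=.
Qed.

(** Seen as the complementation of a two by two rectangle, a swap is visibly reversible, changes at
    most 4 pairs and is determined by its rectangle. *)
Lemma in_swap_set X u1 u2 v1 v2 e :
  u1 != u2 -> v1 != v2 ->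
  (u1, v1) \in X -> (u2, v2) \in X -> (u1, v2) \notin X -> (u2, v1) \notin X ->
  (e \in swap_set X u1 u2 v1 v2) =
  (e \in X) (+) ((e.1 \in [set u1; u2]) && (e.2 \in [set v1; v2])).
Proof.
case: e => u v /= uu vv H1 H2 H3 H4; rewrite !inE !xpair_eqE.
have eu : ~~ ((u == u1) && (u == u2)).
  by apply: contra uu => /andP[/eqP <- /eqP <-].
have ev : ~~ ((v == v1) && (v == v2)).
  by apply: contra vv => /andP[/eqP <- /eqP <-].
have M1 : (u == u1) && (v == v1) ==> ((u, v) \in X).
  by apply/implyP => /andP[/eqP -> /eqP ->].
have M2 : (u == u2) && (v == v2) ==> ((u, v) \in X).
  by apply/implyP => /andP[/eqP -> /eqP ->].
have M3 : (u == u1) && (v == v2) ==> ((u, v) \notin X).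
  by apply/implyP => /andP[/eqP -> /eqP ->].
have M4 : (u == u2) && (v == v1) ==> ((u, v) \notin X).
  by apply/implyP => /andP[/eqP -> /eqP ->].
move: eu ev M1 M2 M3 M4.
by case: (u == u1); case: (u == u2); case: (v == v1); case: (v == v2); case: (_ \in X).
Qed.

Lemma swap_set_deg X u1 u2 v1 v2 :
  u1 != u2 -> v1 != v2 ->
  (u1, v1) \in X -> (u2, v2) \in X -> (u1, v2) \notin X -> (u2, v1) \notin X ->
  same_deg X (swap_set X u1 u2 v1 v2).
Proof.
move=> uu vv H1 H2 H3 H4; split=> [u|v].
  rewrite /degU; case: (eqVneq u u1) => [->|uu1].
    rewrite -(@card_exchange _ [set v | (u1, v) \in X] v1 v2) ?inE //.
    apply: eq_card => v; rewrite [RHS]in_set in_swap_set // !inE /= eqxx /=.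
    case: (eqVneq v v1) => [->|]; first by rewrite H1 (negbTE vv).
    by case: (eqVneq v v2) => [->|]; rewrite ?(negbTE H3) //= addbF.
  case: (eqVneq u u2) => [->|uu2].
    rewrite -(@card_exchange _ [set v | (u2, v) \in X] v2 v1) ?inE //.
    apply: eq_card => v; rewrite [RHS]in_set in_swap_set // !inE /= eqxx orbT /=.
    case: (eqVneq v v2) => [->|]; first by rewrite H2 eq_sym (negbTE vv) orbT.
    by case: (eqVneq v v1) => [->|]; rewrite ?(negbTE H4) //= addbF.
  by apply: eq_card => v; rewrite [RHS]in_set in_swap_set // !inE /= (negbTE uu1) (negbTE uu2) addbF.
rewrite /degV; case: (eqVneq v v1) => [->|vv1].
  rewrite -(@card_exchange _ [set u | (u, v1) \in X] u1 u2) ?inE //.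
  apply: eq_card => u; rewrite [RHS]in_set in_swap_set // !inE /= eqxx andbT.
  case: (eqVneq u u1) => [->|]; first by rewrite H1 (negbTE uu).
  by case: (eqVneq u u2) => [->|]; rewrite ?(negbTE H4) //= addbF.
case: (eqVneq v v2) => [->|vv2].
  rewrite -(@card_exchange _ [set u | (u, v2) \in X] u2 u1) ?inE //.
  apply: eq_card => u; rewrite [RHS]in_set in_swap_set // !inE /= eqxx orbT andbT.
  case: (eqVneq u u2) => [->|]; first by rewrite H2 eq_sym (negbTE uu) orbT.
  by case: (eqVneq u u1) => [->|]; rewrite ?(negbTE H3) //= addbF.
by apply: eq_card => u; rewrite [RHS]in_set in_swap_set // !inE /= (negbTE vv1) (negbTE vv2) andbF addbF.
Qed.

Lemma swap_step_deg X Z : swap_step X Z -> same_deg X Z.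
Proof. by move=> /swap_stepP[u1 [u2 [v1 [v2 [? ? [? ? ? ?] ->]]]]]; apply: swap_set_deg. Qed.

Lemma swap_step_sym X Z : swap_step X Z = swap_step Z X.
Proof.
suff imp X' Z' : swap_step X' Z' -> swap_step Z' X' by apply/idP/idP; apply: imp.
move=> /swap_stepP[u1 [u2 [v1 [v2 [uu vv [H1 H2 H3 H4] ->]]]]].
set W := swap_set _ _ _ _ _; apply/swap_stepP; exists u1, u2, v2, v1.
have W1 : (u1, v2) \in W by rewrite in_swap_set // !inE /= !eqxx orbT (negbTE H3).
have W2 : (u2, v1) \in W by rewrite in_swap_set // !inE /= !eqxx orbT (negbTE H4).
have W3 : (u1, v1) \notin W by rewrite in_swap_set // !inE /= !eqxx H1.
have W4 : (u2, v2) \notin W by rewrite in_swap_set // !inE /= !eqxx !orbT H2.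
split => //; first by rewrite eq_sym.
apply/setP => e; rewrite in_swap_set // 1?eq_sym // in_swap_set // -addbA !inE.
by rewrite [(e.2 == v2) || _]orbC addbb addbF.
Qed.

(** Three disagreements are removed, and at worst the fourth corner becomes a new one. *)
Lemma swap_set_closer X Y u1 u2 v1 v2 (W : {set 'I_n * 'I_m}) :
  u1 != u2 -> v1 != v2 ->
  (u1, v1) \in X -> (u2, v2) \in X -> (u1, v2) \notin X -> (u2, v1) \notin X ->
  W \subset sdiff X Y -> #|W| = 3 ->
  W \subset [set (u1, v1); (u2, v2); (u1, v2); (u2, v1)] ->
  #|sdiff (swap_set X u1 u2 v1 v2) Y| < #|sdiff X Y|.
Proof.
move=> uu vv H1 H2 H3 H4 WD W3 WQ.
set Q := [set _; _; _; _] in WQ.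
have Q4 : #|Q| <= 4.
  rewrite /Q -!setUA; apply: leq_trans (leq_card_setU _ _) _; rewrite cards1.
  rewrite (leq_add2l 1 _ 3); apply: leq_trans (leq_card_setU _ _) _; rewrite cards1.
  by rewrite (leq_add2l 1 _ 2) cards2; case: eqP.
have QW : #|Q :\: W| <= 1 by rewrite cardsD (setIidPr WQ) W3 leq_subLR.
have sub : sdiff (swap_set X u1 u2 v1 v2) Y \subset (sdiff X Y :\: W) :|: (Q :\: W).
  apply/subsetP => -[u v]; rewrite in_setU !in_setD !in_sdiff in_swap_set //=.
  case: (boolP ((u \in [set u1; u2]) && (v \in [set v1; v2]))) => [uv|nuv].
    have uvQ : (u, v) \in Q.
      move: uv; rewrite !inE !xpair_eqE.
      by do 2![case: eqP => _]; do 2![case: eqP => _].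
    rewrite uvQ andbT; case: (boolP ((u, v) \in W)) => [/(subsetP WD)|_]; last by rewrite orbT.
    by rewrite in_sdiff; case: (_ \in X); case: (_ \in Y).
  rewrite addbF => ->; rewrite andbT.
  have -> // : (u, v) \notin W.
  apply/negP => /(subsetP WQ) uvQ; case/negP: nuv; move: uvQ; rewrite !inE !xpair_eqE.
  by do 2![case: eqP => _]; do 2![case: eqP => _].
apply: leq_ltn_trans (subset_leq_card sub) _.
apply: leq_ltn_trans (leq_card_setU _ _) _; rewrite cardsD (setIidPr WD) W3.
have := subset_leq_card WD; rewrite W3 => D3.
by apply: leq_ltn_trans (leq_add (leqnn _) QW) _; rewrite -{2}(subnK D3) ltn_add2l.
Qed.

Definition excess X Y v := #|[set u | ((u, v) \in X) && ((u, v) \notin Y)]|.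

Lemma excessC X Y v : same_deg X Y -> excess X Y v = excess Y X v.
Proof.
move=> [_ /(_ v)]; rewrite /degV /excess.
set A := [set u | (u, v) \in X]; set B := [set u | (u, v) \in Y] => AB.
have -> : [set u | ((u, v) \in X) && ((u, v) \notin Y)] = A :\: B.
  by apply/setP => u; rewrite !inE andbC.
have -> : [set u | ((u, v) \in Y) && ((u, v) \notin X)] = B :\: A.
  by apply/setP => u; rewrite !inE andbC.
by rewrite !cardsD setIC AB.
Qed.

Lemma row_excess X Y u v : same_deg X Y -> (u, v) \in Y -> (u, v) \notin X ->
  exists2 v', (u, v') \in X & (u, v') \notin Y.
Proof.
move=> [/(_ u) dU _] vY vX.
have [/existsP[v' /andP[]]|] := boolP [exists v', ((u, v') \in X) && ((u, v') \notin Y)].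
  by exists v'.
rewrite negb_exists => /forallP H; exfalso.
suff : degU X u < degU Y u by rewrite dU ltnn.
apply/proper_card/properP; split.
  by apply/subsetP => w; rewrite !inE => wX; have := H w; rewrite wX negbK.
by exists v; rewrite inE.
Qed.

(** The corners are chosen with [(u1, v1)] only in [X], [(u1, v2)] and [(u2, v1)] only in [Y], and
    [(u2, v2)] not only in [Y]. If [(u2, v2)] is in [X], the swap is made in [X]; otherwise it is in
    neither graph and the swap is made in [Y]. *)
Lemma exists_closer_swap X Y : same_deg X Y -> X != Y ->
  exists Z, swap_step X Z && (#|sdiff Z Y| < #|sdiff X Y|) ||
            swap_step Y Z && (#|sdiff X Z| < #|sdiff X Y|).
Proof.
move=> dXY XY; have dYX : same_deg Y X by case: dXY => a b; split=> ? //; rewrite ?a ?b.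
have [v0 ev0] : exists v, 0 < excess Y X v.
  have [e] : exists e, e \in sdiff X Y.
    by apply/set0Pn; rewrite -cards_eq0 sdiff_eq0.
  case: e => u v; rewrite in_sdiff => uv; exists v.
  have [/andP[uX uY]|] := boolP (((u, v) \in X) && ((u, v) \notin Y)).
    by rewrite (excessC _ dYX); apply/card_gt0P; exists u; rewrite inE uX.
  by move=> H; apply/card_gt0P; exists u; rewrite inE; move: uv H; case: (_ \in X); case: (_ \in Y).
(* v2 has the least positive excess, so the column v1 found below cannot be
   strictly dominated by it *)
case: (@arg_minnP _ v0 (fun v => 0 < excess Y X v) (excess Y X) ev0) => v2 ev2 min_v2.
have /card_gt0P[u1] := ev2; rewrite inE => /andP[Y12 X12].
have [v1 X11 Y11] := row_excess dXY Y12 X12.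
have vv : v1 != v2 by apply: contraNneq Y11 => ->.
have : ~~ ([set u | ((u, v1) \in Y) && ((u, v1) \notin X)] \subset
           [set u | ((u, v2) \in Y) && ((u, v2) \notin X)]).
  apply/negP => sub; have : excess Y X v1 < excess Y X v2.
    apply/proper_card/properP; split => //.
    by exists u1; rewrite inE ?Y12 // X11 andbF.
  rewrite ltnNge min_v2 // (excessC _ dYX).
  by apply/card_gt0P; exists u1; rewrite inE X11.
case/subsetPn => u2; rewrite !inE => /andP[Y21 X21] Y22.
have uu : u1 != u2 by apply: contraNneq X21 => <-.
have ne1 : (u1, v1) != (u1, v2) by rewrite xpair_eqE eqxx.
have ne2 : (u1, v1) != (u2, v1) by rewrite xpair_eqE eqxx andbT.
have ne3 : (u1, v2) != (u2, v1) by rewrite xpair_eqE (negbTE uu).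
case: (boolP ((u2, v2) \in X)) => [X22|X22].
  exists (swap_set X u1 u2 v1 v2); apply/orP; left; apply/andP; split.
    by apply/swap_stepP; exists u1, u2, v1, v2.
  apply: (@swap_set_closer _ _ _ _ _ _ [set (u1, v1); (u1, v2); (u2, v1)]) => //.
  - apply/subsetP => e; rewrite in_sdiff !inE -orbA => /or3P[] /eqP ->.
    + by rewrite X11 (negbTE Y11).
    + by rewrite Y12 (negbTE X12).
    + by rewrite Y21 (negbTE X21).
  - rewrite setUC cardsU1 cards2 !inE ne1 negb_or.
    by rewrite eq_sym ne2 eq_sym ne3.
  - apply/subsetP => e; rewrite !inE -orbA => /or3P[] /eqP ->;
    by rewrite eqxx ?orbT.
have Y22' : (u2, v2) \notin Y by move: Y22; rewrite X22 andbT.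
exists (swap_set Y u1 u2 v2 v1); apply/orP; right; apply/andP; split.
  by apply/swap_stepP; exists u1, u2, v2, v1; split; rewrite // eq_sym.
rewrite sdiffC (sdiffC X Y).
apply: (@swap_set_closer _ _ _ _ _ _ [set (u1, v1); (u1, v2); (u2, v1)]) => //.
- by rewrite eq_sym.
- apply/subsetP => e; rewrite in_sdiff !inE -orbA => /or3P[] /eqP ->.
  + by rewrite X11 (negbTE Y11).
  + by rewrite Y12 (negbTE X12).
  + by rewrite Y21 (negbTE X21).
- rewrite setUC cardsU1 cards2 !inE ne1 negb_or.
  by rewrite eq_sym ne2 eq_sym ne3.
- apply/subsetP => e; rewrite !inE -orbA => /or3P[] /eqP ->;
  by rewrite eqxx ?orbT.
Qed.

Lemma same_deg_trans X Y Z : same_deg X Y -> same_deg Y Z -> same_deg X Z.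
Proof. by move=> [a b] [c d]; split=> w; rewrite ?a ?b. Qed.

Lemma same_deg_sym X Y : same_deg X Y -> same_deg Y X.
Proof. by move=> [a b]; split=> w; rewrite ?a ?b. Qed.

(** Every swap, on either side, lowers the distance; swaps of [Y] are traversed backwards at the end
    of the path. *)
Lemma swap_path X Y : same_deg X Y ->
  exists p, [/\ path (@swap_step n m) X p, last X p = Y & size p <= #|sdiff X Y|].
Proof.
move: {2}#|_| (leqnn #|sdiff X Y|) => k; elim: k X Y => [|k IH] X Y.
  by rewrite leqn0 sdiff_eq0 => /eqP -> _; exists [::].
move=> Dk dXY; case: (eqVneq X Y) => [->|XY]; first by exists [::].
have [Z /orP[/andP[XZ D]|/andP[YZ D]]] := exists_closer_swap dXY XY.
  have [||p [pp lp sp]] := IH Z Y; first by rewrite -ltnS (leq_trans D).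
    exact: same_deg_trans (same_deg_sym (swap_step_deg XZ)) dXY.
  by exists (Z :: p); rewrite /= XZ; split=> //; apply: leq_ltn_trans sp D.
have [||p [pp lp sp]] := IH X Z; first by rewrite -ltnS (leq_trans D).
  exact: same_deg_trans dXY (swap_step_deg YZ).
exists (rcons p Y); rewrite rcons_path last_rcons size_rcons lp pp swap_step_sym YZ.
by split=> //; apply: leq_ltn_trans sp D.
Qed.

End Swaps.

(** * Stability *)

Section Stability.
Variables n m : nat.
Implicit Types (H G K : {set 'I_n * 'I_m}) (r : 'I_n) (c : 'I_m) (p q w : 'I_n + 'I_m).
Implicit Types (R : {set 'I_n}) (C : {set 'I_m}).

Definition nedges K R C := \sum_(r in R) \sum_(c in C) ((r, c) \in K : nat).

Lemma degUE K r : degU K r = \sum_c ((r, c) \in K : nat).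
Proof. by rewrite /degU -sum1_card big_mkcond; apply: eq_bigr => c _; rewrite inE; case: ifP. Qed.

Lemma degVE K c : degV K c = \sum_r ((r, c) \in K : nat).
Proof. by rewrite /degV -sum1_card big_mkcond; apply: eq_bigr => r _; rewrite inE; case: ifP. Qed.

Lemma sum_degU K R C : \sum_(r in R) degU K r = nedges K R C + nedges K R (~: C).
Proof.
rewrite /nedges -big_split /=; apply: eq_bigr => r _.
rewrite degUE (bigID (mem C)) /=; congr (_ + _).
by apply: eq_bigl => c; rewrite inE.
Qed.

Lemma sum_degV K R C : \sum_(c in C) degV K c = nedges K R C + nedges K (~: R) C.
Proof.
rewrite /nedges exchange_big /= [X in _ + X]exchange_big -big_split /=.
apply: eq_bigr => c _; rewrite degVE (bigID (mem R)) /=; congr (_ + _).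
by apply: eq_bigl => r; rewrite inE.
Qed.

Lemma nedges_le K R C : nedges K R C <= #|R| * #|C|.
Proof.
rewrite /nedges -sum_nat_const leq_sum // => r _.
by rewrite -sum1_card leq_sum // => c _; case: (_ \in K).
Qed.

Lemma nedges_full K R C :
  (forall r c, r \in R -> c \in C -> (r, c) \in K) -> nedges K R C = #|R| * #|C|.
Proof.
move=> full; rewrite /nedges -sum_nat_const; apply: eq_bigr => r rR.
by rewrite -sum1_card; apply: eq_bigr => c cC; rewrite full.
Qed.

Lemma nedges_empty K R C :
  (forall r c, r \in R -> c \in C -> (r, c) \notin K) -> nedges K R C = 0.
Proof.
move=> emp; rewrite /nedges big1 // => r rR; rewrite big1 // => c cC.
by rewrite (negbTE (emp _ _ rR cC)).
Qed.

Lemma degU_D1 K r c r' : (r, c) \in K -> degU (K :\ (r, c)) r' + (r == r') = degU K r'.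
Proof.
move=> rcK; case: (eqVneq r r') => [<-|rr'].
  rewrite addn1 /degU [RHS](cardsD1 c) inE rcK add1n; congr _.+1.
  by apply: eq_card => c'; rewrite !inE xpair_eqE eqxx.
rewrite addn0; apply: eq_card => c'.
by rewrite !inE xpair_eqE [r' == r]eq_sym (negbTE rr').
Qed.

Lemma degV_D1 K r c c' : (r, c) \in K -> degV (K :\ (r, c)) c' + (c == c') = degV K c'.
Proof.
move=> rcK; case: (eqVneq c c') => [<-|cc'].
  rewrite addn1 /degV [RHS](cardsD1 r) inE rcK add1n; congr _.+1.
  by apply: eq_card => r'; rewrite !inE xpair_eqE eqxx andbT.
rewrite addn0; apply: eq_card => r'.
by rewrite !inE xpair_eqE [c' == c]eq_sym (negbTE cc') andbF.
Qed.

Lemma degU_U1 K r c r' : (r, c) \notin K -> degU ((r, c) |: K) r' = degU K r' + (r == r').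
Proof. by move=> rcK; rewrite -(@degU_D1 _ r c) ?setU11 // setU1K. Qed.

Lemma degV_U1 K r c c' : (r, c) \notin K -> degV ((r, c) |: K) c' = degV K c' + (c == c').
Proof. by move=> rcK; rewrite -(@degV_D1 _ r c) ?setU11 // setU1K. Qed.

(* Orient a pair (r, c) from r to c if it is a non-edge of H and from c to r if
   it is an edge.  Flipping all pairs on a directed path from p to w changes
   only the degrees of p and w, in the way expressed here. *)
Definition shifted (du du' : 'I_n -> nat) (dv dv' : 'I_m -> nat) p w :=
  (forall r, du' r + (w == inl r) = du r + (p == inl r)) /\
  (forall c, dv' c + (p == inr c) = dv c + (w == inr c)).

Definition out_rows H C := [set r | [exists c in C, (r, c) \in H]].
Definition out_cols H R := [set c | [exists r in R, (r, c) \notin H]].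

(** One unit of radius adds two layers: rows reached from the old columns, and columns reached from
    the enlarged set of rows. Hence two flips per unit. *)
Fixpoint ball H p t : {set 'I_n} * {set 'I_m} :=
  if t is t'.+1 then
    let R := (ball H p t').1 :|: out_rows H (ball H p t').2 in
    (R, (ball H p t').2 :|: out_cols H R)
  else ([set r | p == inl r], [set c | p == inr c]).

Definition in_ball w (B : {set 'I_n} * {set 'I_m}) :=
  match w with inl r => r \in B.1 | inr c => c \in B.2 end.

(** Confining the flips to the block [setX B.1 B.2] is the invariant of the induction: a pair with
    an end outside the block is still as in [H], so the next arc can be flipped. *)
Definition reachable H p (B : {set 'I_n} * {set 'I_m}) k :=
  forall w, in_ball w B -> exists K,
    [/\ sdiff H K \subset setX B.1 B.2, #|sdiff H K| <= k &
        shifted (degU H) (degU K) (degV H) (degV K) p w].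

Lemma card_sdiff_flip H K K' e : sdiff H K' = e |: sdiff H K -> #|sdiff H K'| <= #|sdiff H K|.+1.
Proof. by move=> ->; apply: leq_trans (leq_card_setU _ _) _; rewrite cards1. Qed.

Lemma reachable_rows H p R C k :
  reachable H p (R, C) k -> reachable H p (R :|: out_rows H C, C) k.+1.
Proof.
move=> reach w wB; case: (boolP (in_ball w (R, C))) => [|wN].
  move=> /reach[K [/= sub le_k sh]]; exists K; split=> //; last exact: leqW.
  by apply: subset_trans sub (setXS _ _); rewrite ?subsetUl.
case: w wB wN => [r|c] /=; last by move=> ->.
rewrite in_setU => /orP[->//|rout] rR; have := rout; rewrite inE => /existsP[c /andP[cC rc]].
have [K [/= sub le_k [shU shV]]] := reach (inr c) cC.
have rcK : (r, c) \in K.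
  apply: contraT => rcK; have : (r, c) \in sdiff H K by rewrite in_sdiff rc (negbTE rcK).
  by move/(subsetP sub); rewrite in_setX (negbTE rR).
have sdE : sdiff H (K :\ (r, c)) = (r, c) |: sdiff H K.
  apply/setP => e; rewrite in_setU1 !in_sdiff in_setD1.
  by case: (eqVneq e (r, c)) => [->|] /=; rewrite ?rc.
exists (K :\ (r, c)); split=> /=.
- rewrite sdE subUset sub1set in_setX !inE cC andbT; apply/andP; split.
    by move: rout; rewrite inE => ->; rewrite orbT.
  by apply: subset_trans sub (setXS _ _); rewrite ?subsetUl.
- by apply: leq_trans (card_sdiff_flip sdE) _.
split=> [r'|c'].
  by have := shU r'; rewrite addn0 => <-; rewrite -(degU_D1 r' rcK).
have := shV c'; rewrite -(degV_D1 c' rcK) addn0.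
have -> : (inr c == inr c' :> 'I_n + 'I_m) = (c == c') by [].
by rewrite addnAC => /eqP; rewrite eqn_add2r => /eqP.
Qed.

Lemma reachable_cols H p R C k :
  reachable H p (R, C) k -> reachable H p (R, C :|: out_cols H R) k.+1.
Proof.
move=> reach w wB; case: (boolP (in_ball w (R, C))) => [|wN].
  move=> /reach[K [/= sub le_k sh]]; exists K; split=> //; last exact: leqW.
  by apply: subset_trans sub (setXS _ _); rewrite ?subsetUl.
case: w wB wN => [r|c] /=; first by move=> ->.
rewrite in_setU => /orP[->//|cout] cC; have := cout; rewrite inE => /existsP[r /andP[rR rc]].
have [K [/= sub le_k [shU shV]]] := reach (inl r) rR.
have rcK : (r, c) \notin K.
  apply/negP => rcK; have : (r, c) \in sdiff H K by rewrite in_sdiff (negbTE rc) rcK.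
  by move/(subsetP sub); rewrite in_setX (negbTE cC) andbF.
have sdE : sdiff H ((r, c) |: K) = (r, c) |: sdiff H K.
  apply/setP => e; rewrite in_setU1 !in_sdiff in_setU1.
  by case: (eqVneq e (r, c)) => [->|] /=; rewrite ?(negbTE rc).
exists ((r, c) |: K); split=> /=.
- rewrite sdE subUset sub1set in_setX !inE rR; apply/andP; split.
    by move: cout; rewrite inE => ->; rewrite orbT.
  by apply: subset_trans sub (setXS _ _); rewrite ?subsetUl.
- by apply: leq_trans (card_sdiff_flip sdE) _.
split=> [r'|c'].
  by have := shU r'; rewrite (degU_U1 r' rcK) addn0 => <-.
by have := shV c'; rewrite (degV_U1 c' rcK) addn0 => <-; rewrite addnAC.
Qed.

Lemma reachable_ball H p t : reachable H p (ball H p t) (2 * t).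
Proof.
elim: t => [|t IH].
  move=> w wB; have wp : w = p by case: w wB => /= x; rewrite inE => /eqP.
  exists H; rewrite wp; split=> //.
    by apply/subsetP => e; rewrite in_sdiff eqxx.
  by rewrite leqn0 sdiff_eq0.
rewrite mulnS add2n [ball _ _ _.+1]/=; case: (ball H p t) IH => R C IH /=.
by apply: reachable_cols; apply: reachable_rows.
Qed.

Section Growth.
Variables (H : {set 'I_n * 'I_m}) (p : 'I_n + 'I_m).
Let R t := (ball H p t).1.
Let C t := (ball H p t).2.

Lemma ball_rowsS t : R t \subset R t.+1. Proof. exact: subsetUl. Qed.
Lemma ball_colsS t : C t \subset C t.+1. Proof. exact: subsetUl. Qed.

Lemma ball_rows_mono s t : s <= t -> R s \subset R t.
Proof.
move=> /subnK <-; elim: (t - s) => [|d IH]; first by rewrite add0n.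
exact: subset_trans IH (ball_rowsS _).
Qed.

Lemma ball_cols_mono s t : s <= t -> C s \subset C t.
Proof.
move=> /subnK <-; elim: (t - s) => [|d IH]; first by rewrite add0n.
exact: subset_trans IH (ball_colsS _).
Qed.

(** There is no index shift here, since columns are computed from the rows of the same radius;
    [ball_empty] loses one unit because rows come from the previous columns. *)
Lemma ball_full t r c : r \in R t.+1 -> c \notin C t.+1 -> (r, c) \in H.
Proof.
move=> rR; apply: contraNT => rc; rewrite inE; apply/orP; right.
by rewrite inE; apply/existsP; exists r; rewrite rR.
Qed.

Lemma ball_empty t r c : r \notin R t.+1 -> c \in C t -> (r, c) \notin H.
Proof.
move=> rR cC; apply: contra rR => rc; rewrite inE; apply/orP; right.
by rewrite inE; apply/existsP; exists c; rewrite cC.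
Qed.

Lemma source_in_ball t : in_ball p (ball H p t).
Proof.
elim: t => [|t]; first by rewrite /=; case: p => x; rewrite /= inE.
by case: p => x /= xB; rewrite inE xB.
Qed.

Variables (du : 'I_n -> nat) (dv : 'I_m -> nat) (q : 'I_n + 'I_m).
Hypothesis near : shifted (degU H) du (degV H) dv p q.
Hypothesis realizable : exists G, realizes du dv G.

(** For a set closed under arcs, the sum of the [H]-degrees over [Rc] minus that over [Cc] is
    [#|Rc| * #|~: Cc|], the maximum for any graph. With [p] inside and [q] outside, the prescribed
    degrees would require one more. *)
Lemma not_closed Rc Cc : in_ball p (Rc, Cc) -> ~~ in_ball q (Rc, Cc) ->
  (forall r c, r \in Rc -> c \notin Cc -> (r, c) \in H) ->
  (forall r c, r \notin Rc -> c \in Cc -> (r, c) \notin H) -> False.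
Proof.
move=> pB qB full emp; have [G /andP[/forallP GU /forallP GV]] := realizable.
have [nU nV] := near.
have HU := sum_degU H Rc Cc; have HV := sum_degV H Rc Cc.
have GU' := sum_degU G Rc Cc; have GV' := sum_degV G Rc Cc.
rewrite (nedges_full (K := H) (R := Rc) (C := ~: Cc)) in HU; last first.
  by move=> r c rR; rewrite inE; apply: full.
rewrite (nedges_empty (K := H) (R := ~: Rc)) in HV; last first.
  by move=> r c; rewrite inE; apply: emp.
have G_le := nedges_le G Rc (~: Cc).
rewrite (eq_bigr du) in GU'; last by move=> r _; apply/eqP.
rewrite (eq_bigr dv) in GV'; last by move=> c _; apply/eqP.
have sU : \sum_(r in Rc) du r = \sum_(r in Rc) degU H r + \sum_(r in Rc) (p == inl r : nat).
  rewrite -big_split; apply: eq_bigr => r rR /=; rewrite -nU.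
  by case: eqP qB => [->|]; rewrite ?addn0 //= rR.
have sV : \sum_(c in Cc) dv c + \sum_(c in Cc) (p == inr c : nat) = \sum_(c in Cc) degV H c.
  rewrite -big_split; apply: eq_bigr => c cC /=; rewrite nV.
  by case: eqP qB => [->|]; rewrite ?addn0 //= cC.
have p1 : \sum_(r in Rc) (p == inl r : nat) + \sum_(c in Cc) (p == inr c : nat) = 1.
  case: (p) pB => x /= xB.
    rewrite (bigD1 x) //= eqxx !big1 // => i /andP[_ ix].
    by rewrite (_ : (inl x == inl i) = (x == i)) // eq_sym (negbTE ix).
  rewrite addnC (bigD1 x) //= eqxx !big1 // => i /andP[_ ix].
  by rewrite (_ : (inr x == inr i) = (x == i)) // eq_sym (negbTE ix).
move: HU HV GU' GV' sU sV p1 G_le.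
set a1 := \sum_(r in Rc) degU H r; set a2 := \sum_(c in Cc) degV H c.
set a3 := \sum_(r in Rc) du r; set a4 := \sum_(c in Cc) dv c.
set a5 := nedges H Rc Cc; set a6 := nedges G Rc Cc; set a7 := nedges G Rc (~: Cc).
set a8 := nedges G (~: Rc) Cc; set a9 := #|Rc| * _.
set b1 := \sum_(r in Rc) _; set b2 := \sum_(c in Cc) _.
clearbody a1 a2 a3 a4 a5 a6 a7 a8 a9 b1 b2; clear; lia.
Qed.

Lemma in_ball_mono s t w : s <= t -> in_ball w (ball H p s) -> in_ball w (ball H p t).
Proof.
move=> st; case: w => x /=; first exact: (subsetP (ball_rows_mono st)).
exact: (subsetP (ball_cols_mono st)).
Qed.

(** A layer that fails to grow leaves a closed set separating [p] from [q]. *)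
Lemma ball_cols_grow t : ~~ in_ball q (ball H p t.+1) -> #|C t| < #|C t.+1|.
Proof.
move=> qB; rewrite ltnNge; apply/negP => le.
have CE : C t = C t.+1 by apply/eqP; rewrite eqEcard ball_colsS.
apply: (@not_closed (R t.+1) (C t.+1)) => [||r c|r c].
- exact: (source_in_ball t.+1).
- exact: qB.
- exact: ball_full.
- by rewrite -CE; apply: ball_empty.
Qed.

Lemma ball_rows_grow t : ~~ in_ball q (ball H p t.+2) -> #|R t.+1| < #|R t.+2|.
Proof.
move=> qB; rewrite ltnNge; apply/negP => le.
have RE : R t.+1 = R t.+2 by apply/eqP; rewrite eqEcard ball_rowsS.
apply: (@not_closed (R t.+1) (C t.+1)) => [||r c|r c].
- exact: (source_in_ball t.+1).
- by apply: contra qB; apply: in_ball_mono.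
- exact: ball_full.
- by rewrite RE; apply: ball_empty.
Qed.

End Growth.

End Stability.

(** * The degree condition forces short repairs *)

Section Bounded.

(** [a] and [p] are the sizes of [R 3] and [C 3], and [E] counts the edges between them. Eliminating
    [E] gives [c1 * p + a * (m - d2) <= a * p], as [growth_Z] requires; the strict growth of the
    layers supplies the units in [a.+1] and [p.+2]. *)
Lemma growth_arith (m c1 c2 d1 d2 a p E : nat) :
  0 < a -> d2 < m -> c1 * p <= E -> E + a * (m - p) <= a * d2 ->
  a.+1 <= c2 -> p.+2 + d1 <= m ->
  ((Z.of_nat c2 - Z.of_nat c1 - 1) * (Z.of_nat d2 - Z.of_nat d1 - 1)
       <= Z.of_nat c1 * (Z.of_nat m - Z.of_nat d2))%Z -> False.
Proof.
move=> a0 d2m cpE Ead ac2 pm hyp.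
have H : c1 * p + a * (m - d2) <= a * p.
  rewrite -(leq_add2r (a * (m - p))) -[X in _ <= X]mulnDr subnKC; last by lia.
  apply: (@leq_trans (a * d2 + a * (m - d2))); last by rewrite -mulnDr subnKC // ltnW.
  by rewrite addnAC leq_add2r; apply: leq_trans Ead; rewrite leq_add2r.
suff : (Z.of_nat c1 * (Z.of_nat m - Z.of_nat d2) <
        (Z.of_nat c2 - Z.of_nat c1 - 1) * (Z.of_nat d2 - Z.of_nat d1 - 1))%Z.
  by move/Z.lt_nge => /(_ hyp).
clear hyp cpE Ead; apply: (@growth_Z (Z.of_nat a) (Z.of_nat p)); lia.
Qed.

Variables (n m c1 c2 d1 d2 : nat) (H : {set 'I_n * 'I_m}) (p q : 'I_n + 'I_m).
Variables (du : 'I_n -> nat) (dv : 'I_m -> nat).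
Hypothesis c2_lt : c2 < n.
Hypothesis d1_gt0 : 0 < d1.
Hypothesis d2_lt : d2 < m.
Hypothesis dv_bound : forall c, c1 <= dv c <= c2.
Hypothesis du_bound : forall r, d1 <= du r <= d2.
Hypothesis near : shifted (degU H) du (degV H) dv p q.
Hypothesis realizable : exists G, realizes du dv G.

Let R t := (ball H p t).1.
Let C t := (ball H p t).2.

Lemma row_deg_le r : q != inl r -> degU H r <= d2.
Proof.
move=> qr; have [/(_ r) + _] := near; rewrite (negbTE qr) addn0 => E.
by have /andP[_] := du_bound r; apply: leq_trans; rewrite E leq_addr.
Qed.

Lemma col_deg_ge c : q != inr c -> c1 <= degV H c.
Proof.
move=> qc; have [_ /(_ c)] := near; rewrite (negbTE qc) addn0 => <-.
by have /andP[le _] := dv_bound c; apply: leq_trans le (leq_addr _ _).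
Qed.

Lemma row_deg_ge r : p != inl r -> d1 <= degU H r.
Proof.
move=> pr; have [/(_ r) + _] := near; rewrite (negbTE pr) addn0 => <-.
by have /andP[le _] := du_bound r; apply: leq_trans le (leq_addr _ _).
Qed.

Lemma col_deg_le c : p != inr c -> degV H c <= c2.
Proof.
move=> pc; have [_ /(_ c)] := near; rewrite (negbTE pc) addn0 => E.
by have /andP[_] := dv_bound c; apply: leq_trans; rewrite E leq_addr.
Qed.

Lemma notin_ball_inl (w : 'I_n + 'I_m) r B : w = inl r -> ~~ in_ball w B -> r \notin B.1.
Proof. by move->. Qed.

Lemma notin_ball_inr (w : 'I_n + 'I_m) c B : w = inr c -> ~~ in_ball w B -> c \notin B.2.
Proof. by move->. Qed.

Lemma in_ball_inl (w : 'I_n + 'I_m) r B : w = inl r -> in_ball w B -> r \in B.1.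
Proof. by move->. Qed.

Lemma in_ball_inr (w : 'I_n + 'I_m) c B : w = inr c -> in_ball w B -> c \in B.2.
Proof. by move->. Qed.

(** If [q] is missed, the edges between [R 3] and [C 3] are counted twice. The columns have at least
    [c1] neighbours in [R 3]; the rows, adjacent to every column outside [C 3], have degree at most
    [d2]. The outer layers bound the block itself, through a column outside [C 5] and a row outside
    [R 6]. *)
Lemma ball_reaches :
  ((Z.of_nat c2 - Z.of_nat c1 - 1) * (Z.of_nat d2 - Z.of_nat d1 - 1)
       <= Z.of_nat c1 * (Z.of_nat m - Z.of_nat d2))%Z ->
  in_ball q (ball H p 6).
Proof.
have fullB t r c : r \in R t.+1 -> c \notin C t.+1 -> (r, c) \in H by exact: ball_full.
have emptyB t r c : r \notin R t.+1 -> c \in C t -> (r, c) \notin H by exact: ball_empty.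
have subR t : R t \subset R t.+1 by exact: ball_rowsS.
have subC t : C t \subset C t.+1 by exact: ball_colsS.
have growR t : ~~ in_ball q (ball H p t.+2) -> #|R t.+1| < #|R t.+2|.
  exact: (ball_rows_grow near realizable).
have growC t : ~~ in_ball q (ball H p t.+1) -> #|C t| < #|C t.+1|.
  exact: (ball_cols_grow near realizable).
move=> hyp; apply: contraT => qB; exfalso; move: hyp.
have qN t : t <= 6 -> ~~ in_ball q (ball H p t).
  by move=> t6; apply: contra qB; apply: in_ball_mono.
have pB t := source_in_ball H p t.
have qRN t r : t <= 6 -> r \in R t -> q != inl r.
  by move=> /qN + rR; apply: contraNneq => ->.
have qCN t c : t <= 6 -> c \in C t -> q != inr c.
  by move=> /qN + cC; apply: contraNneq => ->.
have pRN r : r \notin R 6 -> p != inl r.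
  by apply: contraNneq => E; apply: (in_ball_inl E (pB 6)).
have pCN t c : c \notin C t -> p != inr c.
  by apply: contraNneq => E; apply: (in_ball_inr E (pB t)).
have qRN' t r : t <= 6 -> q = inl r -> r \notin R t.
  by move=> /qN + qr; apply: notin_ball_inl.
have qCN' t c : t <= 6 -> q = inr c -> c \notin C t.
  by move=> /qN + qc; apply: notin_ball_inr.
clearbody R C.
(* [q] itself if it is a column; otherwise a neighbour of the row [q], since rows outside [R 6] have
   no edge into [C 5]. *)
have [cs csN cs_le] : exists2 c, c \notin C 5 & degV H c <= c2.
  case qE : q => [r|c]; last first.
    have qB' : c \notin C 6 := qCN' 6 _ isT qE.
    exists c; last by apply: (col_deg_le (pCN 6 _ qB')).
    by apply: contra qB'; apply: (subsetP (subC 5)).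
  have qB' : r \notin R 6 := qRN' 6 _ isT qE.
  have : 0 < degU H r by apply: leq_trans d1_gt0 (row_deg_ge (pRN _ qB')).
  case/card_gt0P => c; rewrite inE => rc.
  have cN : c \notin C 5 by apply/negP => cC; case/negP: (emptyB 5 _ _ qB' cC).
  by exists c => //; apply: (col_deg_le (pCN _ _ cN)).
(* [q] itself if it is a row; otherwise a row not adjacent to the column [q], since [R 6] is
   completely joined to the columns outside [C 6]. *)
have [rs rsN] : exists r, r \notin R 6.
  case qE : q => [r|c]; first by exists r; apply: (qRN' 6 _ isT qE).
  have qB' : c \notin C 6 := qCN' 6 _ isT qE.
  have lt : degV H c < n by apply: leq_ltn_trans (col_deg_le (pCN 6 _ qB')) c2_lt.
  have : [set r | (r, c) \in H] != setT.
    by apply: contraTneq lt => E; rewrite /degV E cardsT card_ord ltnn.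
  rewrite -properT => /properP[_ [r _]]; rewrite inE => rc; exists r.
  by apply: contra rc => rR; apply: (fullB 5 _ _ rR).
have rs_ge := row_deg_ge (pRN _ rsN).
have m_ge : #|C 5| + d1 <= m.
  apply: (@leq_trans (#|C 5| + #|~: C 5|)); last by rewrite cardsC card_ord.
  rewrite leq_add2l; apply: leq_trans rs_ge _.
  rewrite /degU subset_leq_card //; apply/subsetP => c; rewrite !inE => rc.
  by apply/negP => cC; case/negP: (emptyB 5 _ _ rsN cC).
have R4_le : #|R 4| <= c2.
  apply: leq_trans cs_le; rewrite /degV subset_leq_card //; apply/subsetP => r rR.
  rewrite inE; apply: (fullB 3 _ _ rR); apply: contra csN.
  exact: (subsetP (subC 4)).
have grow_R : #|R 3| < #|R 4| := growR 2 (qN 4 isT).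
have grow_C3 : #|C 3| < #|C 4| := growC 3 (qN 4 isT).
have grow_C4 : #|C 4| < #|C 5| := growC 4 (qN 5 isT).
have R3_gt0 : 0 < #|R 3|.
  exact: leq_ltn_trans (leq0n _) (growR 1 (qN 3 isT)).
have [c0 c0C] : exists c, c \in C 1.
  by apply/set0Pn; rewrite -card_gt0 (leq_ltn_trans _ (growC 0 (qN 1 isT))).
(* All neighbours of a column in [C 1] lie in [R 2]. *)
have R2_ge : c1 <= #|R 2|.
  apply: leq_trans (col_deg_ge (qCN 1 _ isT c0C)) _.
  rewrite /degV subset_leq_card //; apply/subsetP => r; rewrite inE.
  by apply: contraLR => rR; apply: (emptyB 1 _ _ rR).
apply: (@growth_arith m c1 c2 d1 d2 #|R 3| #|C 3| (nedges H (R 3) (C 3))) => //.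
- have -> : nedges H (R 3) (C 3) = \sum_(c in C 3) \sum_(r in R 3) ((r, c) \in H : nat).
    by rewrite /nedges exchange_big.
  rewrite mulnC -sum_nat_const leq_sum // => c cC.
  (* Columns of [C 2] have all their neighbours in [R 3]; the newer ones are adjacent to all of
     [R 2]. *)
  case: (boolP (c \in C 2)) => cC2.
    apply: leq_trans (col_deg_ge (qCN 3 _ isT cC)) _.
    rewrite degVE (bigID (mem (R 3))) /= [X in _ + X]big1 ?addn0 // => r rR.
    by rewrite (negbTE (emptyB 2 _ _ rR cC2)).
  apply: leq_trans R2_ge _; rewrite -sum1_card.
  rewrite [X in _ <= X](bigID (mem (R 2))) /=.
  rewrite [X in _ <= X + _](eq_bigl (mem (R 2))); last first.
    by move=> r; apply/andP/idP => [[]//|rR]; split=> //; apply: (subsetP (subR 2)).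
  apply: (leq_trans _ (leq_addr _ _)); rewrite leq_sum // => r rR.
  by rewrite (fullB 1 _ _ rR cC2).
- have -> : #|R 3| * (m - #|C 3|) = nedges H (R 3) (~: C 3).
    rewrite nedges_full; first by rewrite (cardsCs (~: C 3)) setCK card_ord.
    by move=> r c rR; rewrite inE; apply: (fullB 2 _ _ rR).
  rewrite -sum_degU -sum_nat_const leq_sum // => r rR.
  exact: (row_deg_le (qRN 3 _ isT rR)).
- exact: leq_trans grow_R R4_le.
- apply: leq_trans m_ge; rewrite leq_add2r; exact: leq_trans grow_C4.
Qed.

Lemma near_realization :
  ((Z.of_nat c2 - Z.of_nat c1 - 1) * (Z.of_nat d2 - Z.of_nat d1 - 1)
       <= Z.of_nat c1 * (Z.of_nat m - Z.of_nat d2))%Z ->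
  exists2 G, realizes du dv G & #|sdiff H G| <= 12.
Proof.
move=> /ball_reaches qB; have [G [_ le [sU sV]]] := reachable_ball qB.
have [nU nV] := near; exists G => //; apply/andP; split; apply/forallP.
  move=> r; have := sU r; rewrite -nU => /eqP; by rewrite eqn_add2r.
by move=> c; have := sV c; rewrite -nV => /eqP; rewrite eqn_add2r.
Qed.

End Bounded.

Section Stable.
Variables (n m : nat).

Lemma degU_setC (H : {set 'I_n * 'I_m}) r : degU H r + degU (~: H) r = m.
Proof.
rewrite /degU -[RHS]card_ord -(cardsC [set c | (r, c) \in H]); congr (_ + _).
by apply: eq_card => c; rewrite !inE.
Qed.

Lemma degV_setC (H : {set 'I_n * 'I_m}) c : degV H c + degV (~: H) c = n.
Proof.
rewrite /degV -[RHS]card_ord -(cardsC [set r | (r, c) \in H]); congr (_ + _).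
by apply: eq_card => r; rewrite !inE.
Qed.

(** Complementation exchanges [p] and [q], replaces [c1, c2, d1, d2] by
    [n - c2, n - c1, m - d2, m - d1] and keeps distances. The second term of the maximum turns into
    the first one. *)
Lemma stable (c1 c2 d1 d2 : nat) (du : 'I_n -> nat) (dv : 'I_m -> nat)
  (H : {set 'I_n * 'I_m}) (p q : 'I_n + 'I_m) :
  0 < c1 -> c1 <= c2 -> c2 < n -> 0 < d1 -> d1 <= d2 -> d2 < m ->
  (forall v, c1 <= dv v <= c2) -> (forall u, d1 <= du u <= d2) ->
  ((Z.of_nat c2 - Z.of_nat c1 - 1) * (Z.of_nat d2 - Z.of_nat d1 - 1)
       <= Z.max (Z.of_nat c1 * (Z.of_nat m - Z.of_nat d2))
                (Z.of_nat d1 * (Z.of_nat n - Z.of_nat c2)))%Z ->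
  (exists G, realizes du dv G) ->
  shifted (degU H) du (degV H) dv p q ->
  exists2 G, realizes du dv G & #|sdiff H G| <= 12.
Proof.
move=> c1_gt0 c12 c2n d1_gt0 d12 d2m dvb dub /Z.max_le [alt|hyp].
  by move=> real near; apply: near_realization near real alt.
move=> [G0 realG0] near.
pose du' r := m - du r; pose dv' c := n - dv c.
have du_m r : du r <= m by have /andP[_ le] := dub r; apply: leq_trans le (ltnW d2m).
have dv_n c : dv c <= n by have /andP[_ le] := dvb c; apply: leq_trans le (ltnW c2n).
have realC G : realizes du dv G = realizes du' dv' (~: G).
  congr (_ && _); apply: eq_forallb => x.
    have := degU_setC G x; have := du_m x; rewrite /du'.
    by move: (degU G x) (degU (~: G) x) (du x); lia.
  have := degV_setC G x; have := dv_n x; rewrite /dv'.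
  by move: (degV G x) (degV (~: G) x) (dv x); lia.
have [||||||||G realG le] := @near_realization n m (n - c2) (n - c1) (m - d2) (m - d1) (~: H) q p du' dv'.
- by rewrite ltn_subrL c1_gt0 (leq_ltn_trans _ c2n).
- by rewrite subn_gt0.
- by rewrite ltn_subrL d1_gt0 (leq_ltn_trans _ d2m).
- by move=> c; have := dvb c; rewrite /dv'; lia.
- by move=> r; have := dub r; rewrite /du'; lia.
- have [nU nV] := near; split=> x.
    have := degU_setC H x; have := du_m x; have := nU x; rewrite /du'.
    by move: (degU H x) (degU (~: H) x) (du x) (q == _ : nat) (p == _ : nat); lia.
  have := degV_setC H x; have := dv_n x; have := nV x; rewrite /dv'.
  by move: (degV H x) (degV (~: H) x) (dv x) (q == _ : nat) (p == _ : nat); lia.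
- by exists (~: G0); rewrite -realC.
- by have := c2n; have := d2m; have := c12; have := d12; move: hyp; clear; nia.
exists (~: G); first by rewrite realC setCK.
rewrite (_ : sdiff H (~: G) = sdiff (~: H) G) //.
by apply/setP => e; rewrite !in_sdiff !in_setC; case: (_ \in H); case: (_ \in G).
Qed.

End Stable.

(** * Lifting realizations to permutations *)

Section PermCounting.

Lemma card_perm_eq (T : finType) (s : {perm T}) (A W : {set T}) :
  (forall x, (x \in A) = (s x \in W)) -> #|A| = #|W|.
Proof.
move=> AW; rewrite -(card_preimset W (@perm_inj _ s)).
by apply: eq_card => x; rewrite !inE AW.
Qed.

Lemma card_perm_off (T : finType) (s : {perm T}) (A W : {set T}) x0 :
  (forall x, x != x0 -> (x \in A) = (s x \in W)) ->
  #|A| + (s x0 \in W) = #|W| + (x0 \in A).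
Proof.
move=> AW; rewrite (cardsD1 x0 A) (cardsD1 (s x0) W).
rewrite -(@card_perm_eq _ s (A :\ x0)); first by lia.
by move=> x; rewrite !inE (inj_eq perm_inj); case: (eqVneq x x0) => //= /AW.
Qed.

(** Equal fibre sizes make the two lists of labels rearrangements of each other; the rearrangement
    is the permutation. *)
Lemma perm_of_labels (T : finType) (K : eqType) (a b : T -> K) :
  (forall k, #|[set x | a x == k]| = #|[set x | b x == k]|) ->
  exists s : {perm T}, forall x, b (s x) = a x.
Proof.
move=> ab; pose ta := map_tuple a (enum_tuple T); pose tb := map_tuple b (enum_tuple T).
have cnt (P : pred T) : #|[set x | P x]| = count P (enum T).
  by rewrite cardsE cardE enumT -size_filter.
have pe : perm_eq (map a (enum T)) (map b (enum T)).
  apply/allP => k _ /=; apply/eqP; rewrite count_map [RHS]count_map.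
  by move: (ab k); rewrite !cnt => ->.
have /tuple_permP[p /val_inj E] : perm_eq ta tb by [].
pose f x := enum_val (p (enum_rank x)).
have finj : injective f by move=> x y /enum_val_inj /perm_inj /enum_rank_inj.
exists (perm finj) => x; rewrite permE /f.
have tv i : tnth (enum_tuple T) i = enum_val i by rewrite (tnth_nth x) (enum_val_nth x).
have := congr1 (fun u => tnth u (enum_rank x)) E.
by rewrite tnth_mktuple !tnth_map !tv enum_rankK => ->.
Qed.

Lemma sum_card_fibers (T K : finType) (h : T -> K) : \sum_k #|[set x | h x == k]| = #|T|.
Proof.
rewrite -sum1_card (partition_big h xpredT) //=.
by apply: eq_bigr => k _; rewrite sum1dep_card.
Qed.

End PermCounting.

Section Lifts.
Variables (n m : nat) (du : 'I_n -> nat) (dv : 'I_m -> nat).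
Hypothesis du_m : forall r, du r <= m.
Hypothesis dv_n : forall c, dv c <= n.
Local Notation E := ('I_n * 'I_m)%type.
Local Notation T := (E + E)%type.
Implicit Types (e f : E) (x y : T) (s : {perm T}) (H X : {set E}).

(* Tutte's gadget: both sides of the matching have vertices inl (u, v) and slots
   inr (u, i).  The pair (u, v) is an edge when inl (u, v) is matched to its copy;
   otherwise its left copy uses one of the m - du u slots of row u and its right
   copy one of the n - dv v slots of column v.  The remaining slots only serve to
   make both sides equal in size, and are matched together arbitrarily. *)
Definition row_slot f : option 'I_n := if du f.1 <= f.2 then Some f.1 else None.
Definition col_slot f : option 'I_m := if dv f.2 <= f.1 then Some f.2 else None.

Definition allowed x y : bool :=
  match x, y with
  | inl e, inl e' => e == e'
  | inl e, inr f => row_slot f == Some e.1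
  | inr f, inl e => col_slot f == Some e.2
  | inr f, inr f' => (col_slot f == None) && (row_slot f' == None)
  end.

Definition proj s : {set E} := [set e | s (inl e) == inl e].

(** Vertices that must use a slot of row [r], and these slots; likewise for columns. Their sizes are
    the size of the opposite class minus the actual and minus the prescribed degree, so a matching
    that respects them projects to the right degrees. *)
Definition row_src H r : {set T} :=
  [set x | if x is inl e then (e.1 == r) && (e \notin H) else false].
Definition row_dst r : {set T} := [set y | if y is inr f then row_slot f == Some r else false].
Definition col_src c : {set T} := [set x | if x is inr f then col_slot f == Some c else false].
Definition col_dst H c : {set T} :=
  [set y | if y is inl e then (e.2 == c) && (e \notin H) else false].

Lemma card_row_src H r : #|row_src H r| + degU H r = m.
Proof.
apply: etrans (degU_setC H r); rewrite addnC; congr (_ + _).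
rewrite /degU -(card_imset _ (f := fun c => inl (r, c) : T)); last by move=> ? ? [].
apply: eq_card => -[[r' c]|f]; rewrite !inE /=.
  apply/andP/imsetP => [[/eqP -> rc]|[c' + [-> ->]]]; last by rewrite !inE eqxx.
  by exists c; rewrite ?inE.
by apply/esym/imsetP => -[].
Qed.

Lemma card_col_dst H c : #|col_dst H c| + degV H c = n.
Proof.
apply: etrans (degV_setC H c); rewrite addnC; congr (_ + _).
rewrite /degV -(card_imset _ (f := fun r => inl (r, c) : T)); last by move=> ? ? [].
apply: eq_card => -[[r c']|f]; rewrite !inE /=.
  apply/andP/imsetP => [[/eqP -> rc]|[r' + [-> ->]]]; last by rewrite !inE eqxx.
  by exists r; rewrite ?inE.
by apply/esym/imsetP => -[].
Qed.

Lemma card_ord_ge (k j : nat) : j <= k -> #|[set i : 'I_k | j <= i]| + j = k.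
Proof.
move=> jk; apply: etrans (etrans (cardsC [set i : 'I_k | j <= i]) (card_ord k)); congr (_ + _).
have -> : ~: [set i : 'I_k | j <= i] = [set widen_ord jk i | i : 'I_j].
  apply/setP => i; rewrite !inE -ltnNge; apply/idP/imsetP => [ij|[i' _ ->]]; last exact: (ltn_ord i').
  by exists (Ordinal ij) => //; apply: val_inj.
by rewrite card_imset ?card_ord // => i i' /(congr1 val) /= ii; apply: val_inj.
Qed.

Lemma card_row_dst r : #|row_dst r| + du r = m.
Proof.
apply: etrans (card_ord_ge (du_m r)); congr (_ + _).
rewrite -(card_imset _ (f := fun i => inr (r, i) : T)); last by move=> ? ? [].
apply: eq_card => -[e|[r' i]]; rewrite !inE /row_slot /=.
  by apply/esym/imsetP => -[].
apply/eqP/imsetP => [|[i' + [-> ->]]]; last by rewrite inE => ->.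
by case: ifP => // le [<-]; exists i; rewrite ?inE.
Qed.

Lemma card_col_src c : #|col_src c| + dv c = n.
Proof.
apply: etrans (card_ord_ge (dv_n c)); congr (_ + _).
rewrite -(card_imset _ (f := fun i => inr (i, c) : T)); last by move=> ? ? [].
apply: eq_card => -[e|[i c']]; rewrite !inE /col_slot /=.
  by apply/esym/imsetP => -[].
apply/eqP/imsetP => [|[i' + [-> ->]]]; last by rewrite inE => ->.
by case: ifP => // le [<-]; exists i; rewrite ?inE.
Qed.

Lemma allowed_row s x r : allowed x (s x) -> (x \in row_src (proj s) r) = (s x \in row_dst r).
Proof.
rewrite !inE; case: x => [e|f].
  rewrite inE; case: (s (inl e)) => [e'|f] /=.
    by move/eqP <-; rewrite eqxx andbF.
  by move=> /eqP ->; rewrite andbT.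
by case: (s (inr f)) => [//|f'] /= /andP[_ /eqP ->].
Qed.

Lemma allowed_col s x c : allowed x (s x) -> (x \in col_src c) = (s x \in col_dst (proj s) c).
Proof.
rewrite !inE; case: x => [e|f].
  case sE: (s (inl e)) => [e'|//] /= /eqP ee; subst e'.
  by rewrite inE sE eqxx andbF.
case sE: (s (inr f)) => [e|f'] /=; last by case/andP => /eqP ->.
move=> /eqP ->; rewrite inE (_ : (s (inl e) == inl e) = false) ?andbT //.
by apply/eqP => E; have := perm_inj (etrans E (esym sE)).
Qed.

Lemma perfect_realizes s : perfect allowed s -> realizes du dv (proj s).
Proof.
move=> /forallP al; apply/andP; split; apply/forallP => i; apply/eqP.
  have := card_perm_eq (fun x => allowed_row i (al x)).
  have := card_row_src (proj s) i; have := card_row_dst i.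
  by move: #|row_src _ _| #|row_dst _| (degU _ _) (du i); lia.
have := card_perm_eq (fun x => allowed_col i (al x)).
have := card_col_dst (proj s) i; have := card_col_src i.
by move: #|col_src _| #|col_dst _ _| (degV _ _) (dv i); lia.
Qed.

Hypothesis realizable : exists G, realizes du dv G.

Lemma sum_du_dv : \sum_r du r = \sum_c dv c.
Proof.
have [G /andP[/forallP GU /forallP GV]] := realizable.
rewrite -(eq_bigr _ (fun r _ => eqP (GU r))) -(eq_bigr _ (fun c _ => eqP (GV c))).
under eq_bigr do rewrite degUE; under [RHS]eq_bigr do rewrite degVE.
exact: exchange_big.
Qed.

(** The forbidden entry is the sole exception to the slot counts: [x0] accounts for one vertex [p]
    and its image for one vertex [q]. *)
Lemma near_perfect_shifted s : near_perfect allowed s ->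
  exists p q, shifted (degU (proj s)) du (degV (proj s)) dv p q.
Proof.
move=> /existsP[x0 /forallP al].
have al' x : x != x0 -> allowed x (s x) by apply/implyP.
have [al0|bad] := boolP (allowed x0 (s x0)).
  have : perfect allowed s by apply/forallP => x; case: (eqVneq x x0) => [->|/al'].
  move=> /perfect_realizes /andP[/forallP GU /forallP GV].
  have p : 'I_n + 'I_m by case: x0 {al al' al0} => -[r _]; left.
  by exists p, p; split=> i; rewrite ?(eqP (GU i)) ?(eqP (GV i)).
have rowE r : degU (proj s) r + (x0 \in row_src (proj s) r) = du r + (s x0 \in row_dst r).
  have := card_perm_off (fun x xx0 => allowed_row r (al' x xx0)).
  have := card_row_src (proj s) r; have := card_row_dst r.
  by move: #|row_src _ _| #|row_dst _| (degU _ _) (du r) (x0 \in _ : nat) (s x0 \in _ : nat); lia.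
have colE c : degV (proj s) c + (s x0 \in col_dst (proj s) c) = dv c + (x0 \in col_src c).
  have := card_perm_off (fun x xx0 => allowed_col c (al' x xx0)).
  have := card_col_dst (proj s) c; have := card_col_src c.
  by move: #|col_src _| #|col_dst _ _| (degV _ _) (dv c) (x0 \in _ : nat) (s x0 \in _ : nat); lia.
(* A slot that belongs to no column, or to no row, accounts for no vertex; hence the options. *)
pose p : option ('I_n + 'I_m) := match x0 with
  | inl e => Some (inl e.1) | inr f => omap inr (col_slot f) end.
pose q : option ('I_n + 'I_m) := match s x0 with
  | inl e => Some (inr e.2) | inr f => omap inl (row_slot f) end.
have pr r : (x0 \in row_src (proj s) r) = (p == Some (inl r)).
  rewrite /p inE; case: x0 bad {al al' rowE colE p q} => [e|f] bad; last by case: col_slot.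
  rewrite inE (_ : (s (inl e) == inl e) = false) ?andbT //.
  by apply: contraNF bad => /eqP ->; rewrite /= eqxx.
have pc c : (x0 \in col_src c) = (p == Some (inr c)).
  by rewrite /p inE; case: (x0) => [//|f]; case: col_slot.
have qr r : (s x0 \in row_dst r) = (q == Some (inl r)).
  by rewrite /q inE; case: (s x0) => [//|f]; case: row_slot.
have qc c : (s x0 \in col_dst (proj s) c) = (q == Some (inr c)).
  rewrite /q inE; case sE: (s x0) => [e|f]; last by case: row_slot.
  rewrite inE (_ : (s (inl e) == inl e) = false) ?andbT //.
  apply: contraNF bad => /eqP se; have -> : x0 = inl e by apply: (@perm_inj _ s); rewrite sE se.
  by rewrite se /= eqxx.
have sum_node (w : option ('I_n + 'I_m)) :
    \sum_r (w == Some (inl r) : nat) + \sum_c (w == Some (inr c) : nat) = isSome w.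
  case: w => [[i|i]|].
  - rewrite (bigD1 i) //= eqxx !big1 // => j ji.
    by apply/eqP; rewrite eqb0; apply: contra ji => /eqP [->].
  - rewrite addnC (bigD1 i) //= eqxx !big1 // => j ji.
    by apply/eqP; rewrite eqb0; apply: contra ji => /eqP [->].
  - by rewrite !big1.
have sumU : \sum_r degU (proj s) r + \sum_r (p == Some (inl r) : nat) =
            \sum_r du r + \sum_r (q == Some (inl r) : nat).
  by rewrite -!big_split; apply: eq_bigr => r _; rewrite /= -pr -qr rowE.
have sumV : \sum_c degV (proj s) c + \sum_c (q == Some (inr c) : nat) =
            \sum_c dv c + \sum_c (p == Some (inr c) : nat).
  by rewrite -!big_split; apply: eq_bigr => c _; rewrite /= -pc -qc colE.
have sumUV : \sum_r degU (proj s) r = \sum_c degV (proj s) c.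
  by under eq_bigr do rewrite degUE; under [RHS]eq_bigr do rewrite degVE; apply: exchange_big.
(* Row and column degree sums agree, both for the projection and as prescribed, so the two defects
   occur together. Were both absent, the entry would be allowed. *)
have pq : isSome p = isSome q.
  apply: (can_inj oddb); rewrite -!sum_node.
  move: sumU sumV; rewrite sumUV sum_du_dv.
  move: (\sum_c degV _ _) (\sum_c dv c) (\sum_r (p == _ : nat)) (\sum_r (q == _ : nat))
    (\sum_c (p == _ : nat)) (\sum_c (q == _ : nat)) => a b c d e f; lia.
case pE: p pq => [p'|]; case qE: q => [q'|] // _; last first.
  case/negP: bad; move: pE qE; rewrite /p /q; clear.
  case: x0 => [e|f] //; case fE: (col_slot f) => [//|] _.
  by case: (s (inr f)) => [//|f']; case f'E: (row_slot f') => [//|] _ /=; rewrite fE f'E.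
exists p', q'; split=> [r|c].
  by have := rowE r; rewrite pr qr pE qE => ->.
by have := colE c; rewrite pc qc pE qE => ->.
Qed.

(** The labels say what a vertex must be matched to: edges of [X] to their own copy, the rest by row
    or column. Then [b (s x) = a x] forces both allowedness and the projection. *)
Lemma lift_exists X : realizes du dv X -> exists2 s, perfect allowed s & proj s = X.
Proof.
move=> /andP[/forallP XU /forallP XV].
pose K : finType := option (E + ('I_n + 'I_m)).
pose a x : K := match x with
  | inl e => if e \in X then Some (inl e) else Some (inr (inl e.1))
  | inr f => omap (inr \o inr) (col_slot f) end.
pose b y : K := match y with
  | inl e => if e \in X then Some (inl e) else Some (inr (inr e.2))
  | inr f => omap (inr \o inl) (row_slot f) end.
have abS k : k != None -> #|[set x | a x == k]| = #|[set x | b x == k]|.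
  case: k => [[e|[r|c]]|//] _.
  - apply: eq_card => -[e'|f]; rewrite !inE /=.
      by case: ifP.
    by case: col_slot; case: row_slot.
  - have -> : [set x | a x == Some (inr (inl r))] = row_src X r.
      apply/setP => -[e|f]; rewrite !inE /=; last by case: col_slot.
      by case: (e \in X); rewrite ?andbF ?andbT.
    have -> : [set x | b x == Some (inr (inl r))] = row_dst r.
      apply/setP => -[e|f]; rewrite !inE /=; last by case: row_slot.
      by case: (e \in X).
    by apply/eqP; rewrite -(eqn_add2r (du r)) card_row_dst -(eqP (XU r)) card_row_src.
  - have -> : [set x | a x == Some (inr (inr c))] = col_src c.
      apply/setP => -[e|f]; rewrite !inE /=; last by case: col_slot.
      by case: (e \in X).
    have -> : [set x | b x == Some (inr (inr c))] = col_dst X c.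
      apply/setP => -[e|f]; rewrite !inE /=; last by case: row_slot.
      by case: (e \in X); rewrite ?andbF ?andbT.
    by apply/eqP; rewrite -(eqn_add2r (dv c)) card_col_src -(eqP (XV c)) card_col_dst.
have [|s sE] := @perm_of_labels _ _ a b.
  move=> k; case: (eqVneq k None) => [->|]; last exact: abS.
  (* The fibres of [None], the spare slots, agree by subtraction from the total. *)
  have := sum_card_fibers a; rewrite -(sum_card_fibers b) (bigD1 None) //= [RHS](bigD1 None) //=.
  by rewrite (eq_bigr _ abS) => /eqP; rewrite eqn_add2r => /eqP.
have projE : proj s = X.
  apply/setP => e; rewrite inE; have := sE (inl e) => /=.
  case: ifP => eX.
    case: (s (inl e)) => [e'|f] /=; last by case: row_slot.
    by case: ifP => // _ [->]; rewrite eqxx.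
  case: (s (inl e)) => [e'|f] //=; case: ifP => //.
exists s => //; apply/forallP => x; have := sE x; case: x => [e|f] /=.
  case: ifP => eX; case: (s (inl e)) => [e'|f'] /=; try by case: row_slot.
  - by case: ifP => // _ [->].
  - by case: ifP.
  - by case: row_slot => //= r [->].
case: (s (inr f)) => [e|f'] /=.
  case: ifP => eX; first by case: col_slot.
  by case: col_slot => //= c [->].
by case: col_slot => [c|]; case: row_slot.
Qed.

End Lifts.

(** * Counting lifts by a group of relabelings *)

Section Relabel.
Variables (n m : nat) (du : 'I_n -> nat) (dv : 'I_m -> nat).
Local Notation E := ('I_n * 'I_m)%type.
Local Notation T := (E + E)%type.
Local Notation row_slot := (row_slot du).
Local Notation col_slot := (col_slot dv).
Local Notation allowed := (allowed du dv).
Implicit Types (e f : E) (x y : T) (s t : {perm T}) (H X : {set E}) (g h : {perm T} * {perm T}).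

(* The relabelings permute the slots of each row and of each column.  They act
   freely on the lifts of a realization, and transitively (up to the choice of one
   forbidden entry) on the near lifts of any graph; this replaces the exact count
   of the lifts. *)
Definition src_label x : T + 'I_m :=
  if x is inr f then if col_slot f is Some c then inr c else inl x else inl x.
(** Spare slots have individual labels on the left, hence are fixed there, but share [inr None] on
    the right: permuting them on both sides would spoil freeness. *)
Definition dst_label y : E + option 'I_n :=
  match y with inl e => inl e | inr f => inr (row_slot f) end.

Definition relabelings : {set {perm T} * {perm T}} :=
  [set g : {perm T} * {perm T} | [forall x, src_label (g.1 x) == src_label x] &&
           [forall y, dst_label (g.2 y) == dst_label y]].

Definition relabel g s : {perm T} := (g.1 * s * g.2)%g.

Lemma relabelE g s x : relabel g s x = g.2 (s (g.1 x)).
Proof. by rewrite /relabel !permM. Qed.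

Lemma allowed_src x x' y : src_label x = src_label x' -> allowed x y = allowed x' y.
Proof.
case: x x' => [e|f] [e'|f'] /=.
- by move=> [->].
- by case: (col_slot f').
- by case: (col_slot f).
case fE : (col_slot f) => [c|]; case fE' : (col_slot f') => [c'|] //.
  by move=> [->]; case: y.
Qed.

Lemma allowed_dst x y y' : dst_label y = dst_label y' -> allowed x y = allowed x y'.
Proof.
case: y y' => [e|f] [e'|f'] //= [yy]; first by rewrite yy.
by case: x => [e|f0] /=; rewrite yy.
Qed.

Lemma relabel_perfect g s : g \in relabelings -> perfect allowed s -> perfect allowed (relabel g s).
Proof.
rewrite inE => /andP[/forallP g1 /forallP g2] /forallP al; apply/forallP => x.
by rewrite relabelE (allowed_dst _ (eqP (g2 _))) -(allowed_src _ (eqP (g1 x))).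
Qed.

Lemma relabel_src_inl g e : g \in relabelings -> g.1 (inl e) = inl e.
Proof.
rewrite inE => /andP[/forallP/(_ (inl e))/eqP + _]; rewrite /src_label.
by case: (g.1 (inl e)) => [e' [->]//|f]; case: (col_slot f).
Qed.

Lemma relabel_dst_inl g e : g \in relabelings -> g.2 (inl e) = inl e.
Proof.
rewrite inE => /andP[_ /forallP/(_ (inl e))/eqP]; rewrite /dst_label.
by case: (g.2 (inl e)) => [e' [->]|].
Qed.

Lemma relabel_proj g s : g \in relabelings -> proj (relabel g s) = proj s.
Proof.
move=> gG; apply/setP => e; rewrite !inE relabelE relabel_src_inl //.
by rewrite -{2}(relabel_dst_inl e gG) (inj_eq perm_inj).
Qed.

(** A column slot is matched to some [inl e], which the right factor fixes, so the left factor can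
    be read off; the right one follows. *)
Lemma relabel_inj s : perfect allowed s -> {in relabelings &, injective (relabel^~ s)}.
Proof.
move=> /forallP al g h gG hG E.
have E1 x : g.2 (s (g.1 x)) = h.2 (s (h.1 x)) by rewrite -!relabelE E.
have fix1 k x : k \in relabelings -> src_label x = inl x -> k.1 x = x.
  rewrite inE => /andP[/forallP/(_ x)/eqP + _] xE; rewrite xE /src_label.
  by case: (k.1 x) => [e [->]|f] //; case: (col_slot f) => // -[].
have real1 k x c : k \in relabelings -> src_label x = inr c -> exists e, s (k.1 x) = inl e.
  rewrite inE => /andP[/forallP/(_ x)/eqP + _] xE; rewrite xE /src_label.
  case kE: (k.1 x) => [e|f] //; case fE: (col_slot f) => [c'|//] _.
  by have := al (inr f); case: (s (inr f)) => [e _|f'] /=; [exists e|rewrite fE].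
have gh1 : g.1 = h.1.
  apply/permP => x; case xE: (src_label x) => [x'|c].
    have xx : src_label x = inl x.
      by move: xE; rewrite /src_label; case: (x) => // f; case: (col_slot f).
    by rewrite !fix1.
  have [e ge] := real1 g x c gG xE; have [e' he] := real1 h x c hG xE.
  apply: (@perm_inj _ s); have := E1 x.
  by rewrite ge he (relabel_dst_inl e gG) (relabel_dst_inl e' hG).
have gh2 : g.2 = h.2.
  apply/permP => y; have := E1 ((g.1)^-1%g (s^-1%g y)).
  by rewrite -gh1 !permKV.
by rewrite [g]surjective_pairing [h]surjective_pairing gh1 gh2.
Qed.

(** Relative to one such lift [t], every [s] yields a relabeling: [s * t^-1] on the left column
    slots and [t^-1 * s] on the right slots. Prescribing the exceptional entry makes it common to
    [s] and [t], so it does no harm. *)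
Lemma card_near_lifts_at H x0 y0 :
  #|[set s : {perm T} | [&& [forall x, (x != x0) ==> allowed x (s x)], s x0 == y0 & proj s == H]]|
    <= #|relabelings|.
Proof.
set S := [set s | _].
case: (set_0Vmem S) => [->|[t tS]]; first by rewrite cards0.
have SP s : s \in S ->
    [/\ forall x, x != x0 -> allowed x (s x), s x0 = y0 & proj s = H].
  rewrite inE => /and3P[/forallP al /eqP -> /eqP ->]; split=> // x.
  exact/implyP.
have edgeP s e : s \in S -> (e \in H) = (s (inl e) == inl e).
  by case/SP => _ _ <-; rewrite inE.
have [tal tx0 tH] := SP t tS.
pose I := [set y : T | if y is inr _ then true else false].
pose J := [set x : T | if src_label x is inr _ then true else false].
have stepI s y : s \in S -> y \in I ->
    dst_label ((t^-1 * s)%g y) = dst_label y /\ (t^-1 * s)%g y \in I.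
  move=> sS; have [sal sx0 sH] := SP s sS; rewrite permM.
  move: ((t^-1)%g y) (permKV t y) => z tz yI.
  case: (eqVneq z x0) => [zx|zx]; first by rewrite zx sx0 -tx0 -zx tz.
  have := tal z zx; have := sal z zx; rewrite tz {zx}.
  case: y yI tz => [e|f]; first by rewrite inE.
  move=> _; case: z => [e|f0] tz; rewrite /dst_label.
    have eH : e \notin H by rewrite (edgeP t) // tz.
    case sE: (s (inl e)) => [e'|f'].
      by move=> /eqP ee; move: eH; rewrite (edgeP s) // sE ee eqxx.
    by move=> /eqP -> /eqP ->; rewrite inE.
  case: (s (inr f0)) => [e|f'].
    by rewrite /= => /eqP ->.
  by rewrite /= => /andP[_ /eqP ->] /andP[_ /eqP ->]; rewrite inE.
have stepJ s x : s \in S -> x \in J ->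
    src_label ((s * t^-1)%g x) = src_label x /\ (s * t^-1)%g x \in J.
  move=> sS xJ; have [sal sx0 sH] := SP s sS; rewrite permM.
  suff : src_label ((t^-1)%g (s x)) = src_label x.
    by move=> lE; split=> //; move: xJ; rewrite !inE lE.
  move: ((t^-1)%g (s x)) (permKV t (s x)) => w tw.
  case: (eqVneq x x0) => [xx|xx].
    by congr src_label; apply: (@perm_inj _ t); rewrite tw xx sx0 tx0.
  have wx : w != x0.
    by apply: contra_neq xx => wE; apply: (@perm_inj _ s); rewrite -tw wE sx0 tx0.
  have := tal w wx; have := sal x xx; rewrite tw.
  move: xJ; rewrite inE /src_label; case: x xx tw => [//|f] xx tw.
  case fE: (col_slot f) => [c|//] _; case sE: (s (inr f)) tw => [e|f'] tw /=; last by rewrite fE.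
  rewrite fE => /eqP[->].
  have eH : e \notin H.
    by rewrite (edgeP s) //; apply/eqP; rewrite -[RHS]sE => /perm_inj.
  case: w wx tw => [e'|f'] wx tw /=.
    by move=> /eqP ee; move: eH; rewrite (edgeP t) // -{1}ee tw eqxx.
  by move=> /eqP ->.
have normI s : s \in S -> (t^-1 * s)%g \in 'N(I | 'P)%g.
  move=> sS; rewrite inE in_setT /= inE; apply/subsetP => y yI.
  by rewrite inE /= /aperm; case: (stepI s y).
have normJ s : s \in S -> (s * t^-1)%g \in 'N(J | 'P)%g.
  move=> sS; rewrite inE in_setT /= inE; apply/subsetP => y yJ.
  by rewrite inE /= /aperm; case: (stepJ s y).
pose gam s := (restr_perm J (s * t^-1)%g, restr_perm I (t^-1 * s)%g).
have gamG s : s \in S -> gam s \in relabelings.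
  move=> sS; rewrite inE; apply/andP; split; apply/forallP => x; apply/eqP.
    case: (boolP (x \in J)) => xJ; last by rewrite (out_perm (restr_perm_on _ _)).
    by rewrite restr_permE ?normJ //; case: (stepJ s x).
  case: (boolP (x \in I)) => xI; last by rewrite (out_perm (restr_perm_on _ _)).
  by rewrite restr_permE ?normI //; case: (stepI s x).
(* A point outside [J] that [t] sends to no slot is [x0] or an edge of [H], and there [s] is
   known. *)
have gam_inj : {in S &, injective gam}.
  move=> s s' sS s'S [EJ EI]; apply/permP => x.
  have [_ sx0 _] := SP s sS; have [_ s'x0 _] := SP s' s'S.
  case: (boolP (x \in J)) => xJ.
    have := congr1 (fun p : {perm T} => p x) EJ; rewrite !restr_permE ?normJ // !permM.
    exact: perm_inj.
  case: (boolP (t x \in I)) => xI.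
    have := congr1 (fun p : {perm T} => p (t x)) EI; rewrite !restr_permE ?normI // !permM.
    by rewrite permK.
  case: (eqVneq x x0) => [->|xx]; first by rewrite sx0 s'x0.
  have := tal x xx; case tE: (t x) xI => [e|f]; last by rewrite inE.
  move=> _; case: x xJ tE {xx} => [e'|f] xJ tE /=.
    move=> /eqP ee; subst e'.
    have eH : e \in H by rewrite (edgeP t) // tE eqxx.
    by move: (eH); rewrite (edgeP s) // => /eqP ->; move: eH; rewrite (edgeP s') // => /eqP ->.
  by move: xJ; rewrite inE /=; case: (col_slot f).
rewrite -(card_in_imset gam_inj) subset_leq_card //.
by apply/subsetP => _ /imsetP[s sS ->]; apply: gamG.
Qed.

Lemma card_near_lifts H :
  #|[set s : {perm T} | near_perfect allowed s && (proj s == H)]| <= #|{: T}| ^ 2 * #|relabelings|.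
Proof.
pose S x0 y0 := [set s : {perm T} | [&& [forall x, (x != x0) ==> allowed x (s x)], s x0 == y0 & proj s == H]].
apply: (@leq_trans (\sum_(x0 : T) \sum_(y0 : T) #|S x0 y0|)).
  rewrite -sum1_card.
  under [X in _ <= X]eq_bigr => x0 _ do under eq_bigr => y0 _ do rewrite -sum1_card big_mkcond.
  rewrite [X in _ <= X](eq_bigr (fun x0 => \sum_s \sum_y0 (if s \in S x0 y0 then 1 else 0)));
    last by move=> x0 _; apply: exchange_big.
  rewrite [X in _ <= X]exchange_big /= big_mkcond /= leq_sum // => s _.
  rewrite inE; case: ifP => // /andP[/existsP[x0 al] pH].
  by rewrite (bigD1 x0) //= (bigD1 (s x0)) //= inE al pH eqxx.
apply: (@leq_trans (\sum_(x0 : T) \sum_(y0 : T) #|relabelings|)).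
  by apply: leq_sum => x0 _; apply: leq_sum => y0 _; apply: card_near_lifts_at.
by rewrite !sum_nat_const mulnA.
Qed.

End Relabel.

(** * The Poincare inequality *)

Section SmallSets.
Local Open Scope ring_scope.

Lemma card_small_sets (T : finType) k : (#|[set S : {set T} | (#|S| <= k)%N]| <= #|T|.+1 ^ k)%N.
Proof.
rewrite -card_option -card_tuple.
apply: (leq_trans (n := #|[set [set e | Some e \in (t : k.-tuple (option T))] | t : k.-tuple (option T)]|)); last first.
  exact: leq_trans (leq_imset_card _ _) (max_card _).
rewrite subset_leq_card //; apply/subsetP => S; rewrite inE => Sk.
pose s := map Some (enum S) ++ nseq (k - #|S|) None.
have sz : size s == k by rewrite size_cat size_map size_nseq -cardE subnKC.
apply/imsetP; exists (Tuple sz) => //; apply/setP => e; rewrite inE /= /s mem_cat.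
rewrite (mem_map (@Some_inj _)) mem_enum mem_nseq.
by rewrite (_ : (Some e == None) = false) // andbF orbF.
Qed.

End SmallSets.

Section Compare.
Local Open Scope ring_scope.
Variables (n m : nat) (du : 'I_n -> nat) (dv : 'I_m -> nat).
Local Notation E := ('I_n * 'I_m)%type.
Local Notation T := (E + E)%type.
Implicit Types (H X Y Z : {set E}) (s : {perm T}).
Local Notation real := (realizes du dv).
Local Notation near := (near_perfect (allowed du dv)).
Local Notation perfect := (perfect (allowed du dv)).

Lemma card_sdiff_ball Z k : (#|[set H | #|sdiff H Z| <= k]| <= #|{: E}|.+1 ^ k)%N.
Proof.
apply: leq_trans (card_small_sets _ k).
rewrite -(card_in_imset (f := fun H => sdiff H Z) (D := [set H | (#|sdiff H Z| <= k)%N])).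
  by rewrite subset_leq_card //; apply/subsetP => _ /imsetP[H + ->]; rewrite !inE.
move=> H H' _ _ /setP HH; apply/setP => e; have := HH e; rewrite !in_sdiff.
by case: (e \in H); case: (e \in H'); case: (e \in Z).
Qed.

Variable F : realFieldType.
Variable f : {set E} -> F.

Definition swap_energy : F := \sum_(Z | real Z) \sum_(W | real W && swap_step Z W) (f Z - f W) ^+ 2.

(** Taking all swaps near [X] instead of those of one path leaves a single count: how many
    permutations lie near a given swap. *)
Definition local_energy X r : F :=
  \sum_(Z | real Z && (#|sdiff X Z| <= r)%N) \sum_(W | real W && swap_step Z W) (f Z - f W) ^+ 2.

Lemma local_energy_ge0 X r : 0 <= local_energy X r.
Proof. by apply: sumr_ge0 => Z _; apply: sumr_ge0 => W _; apply: sqr_ge0. Qed.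

Lemma swap_step_real Z W : swap_step Z W -> real Z -> real W.
Proof.
move=> /swap_step_deg[dU dV] /andP[/forallP ZU /forallP ZV].
by apply/andP; split; apply/forallP => i; rewrite -?dU -?dV.
Qed.

Lemma card_swap_step Z W : swap_step Z W -> (#|sdiff Z W| <= 4)%N.
Proof.
move=> /swap_stepP[u1 [u2 [v1 [v2 [uu vv [H1 H2 H3 H4] ->]]]]].
apply: (@leq_trans #|setX [set u1; u2] [set v1; v2]|); last first.
  by rewrite cardsX !cards2 uu vv.
rewrite subset_leq_card //; apply/subsetP => e; rewrite in_sdiff in_swap_set //.
by case: e => u v; rewrite in_setX /=; case: (_ \in Z); case: (_ && _).
Qed.

(** Using [(a + b)^2 <= 2 a^2 + 2 b^2] costs at most a factor 4 per swap, harmless on paths of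
    bounded length. A swap changes at most 4 pairs, whence [4 * size p]. *)
Lemma local_energy_path X r Z p : real Z -> path (@swap_step n m) Z p ->
  (#|sdiff X Z| + 4 * size p <= r)%N ->
  (f Z - f (last Z p)) ^+ 2 <= 4 ^+ size p * local_energy X r.
Proof.
elim: p Z => [|W p IH] Z realZ /=.
  by rewrite subrr expr0n mulr_ge0 ?local_energy_ge0.
move=> /andP[ZW Wp] le_r; have realW := swap_step_real ZW realZ.
have XW : (#|sdiff X W| + 4 * size p <= r)%N.
  apply: leq_trans le_r; rewrite mulnS addnA leq_add2r.
  by apply: leq_trans (sdiff_triangle X Z W) _; rewrite leq_add2l card_swap_step.
have {IH} := IH W realW Wp XW; set D := f W - _ => HD.
have step : (f Z - f W) ^+ 2 <= local_energy X r.
  rewrite /local_energy (bigD1 Z) /=; last first.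
    by rewrite realZ; apply: leq_trans le_r; rewrite leq_addr.
  rewrite (bigD1 W) /= ?realW // -addrA lerDl addr_ge0 //.
    by apply: sumr_ge0 => ? _; apply: sqr_ge0.
  by apply: sumr_ge0 => ? _; apply: sumr_ge0 => ? _; apply: sqr_ge0.
have -> : f Z - f (last W p) = (f Z - f W) + D by rewrite /D; ring.
have p1 : 1 <= 4 ^+ size p :> F by apply: exprn_ege1; rewrite ler1n.
have L0 := local_energy_ge0 X r.
rewrite [4 ^+ _]exprS; move: (f Z - f W) D (local_energy X r) (4 ^+ size p) HD step p1 L0 => a b L c.
move=> H1 H2 H3 H4.
have : (a + b) ^+ 2 <= 2 * a ^+ 2 + 2 * b ^+ 2 by have := sqr_ge0 (a - b); nra.
move/le_trans; apply; nra.
Qed.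

Lemma local_energy_bound X Y k : real X -> real Y -> (#|sdiff X Y| <= k)%N ->
  (f X - f Y) ^+ 2 <= 4 ^+ k * local_energy X (4 * k).
Proof.
move=> /[dup] realX /andP[/forallP XU /forallP XV] /andP[/forallP YU /forallP YV] XY.
have [|p [pp lp sp]] := @swap_path n m X Y.
  by split=> i; rewrite ?(eqP (XU i)) ?(eqP (XV i)) ?(eqP (YU i)) ?(eqP (YV i)).
have pk : (size p <= k)%N by apply: leq_trans XY.
have := @local_energy_path X (4 * k) X p realX pp; rewrite lp => /(_ _)/le_trans; apply.
  have -> : #|sdiff X X| = 0%N by apply/eqP; rewrite sdiff_eq0.
  by rewrite add0n leq_mul2l pk.
by rewrite ler_wpM2r ?local_energy_ge0 // ler_weXn2l // ler1n.
Qed.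

Hypothesis du_m : forall r, (du r <= m)%N.
Hypothesis dv_n : forall c, (dv c <= n)%N.
Hypothesis realizable : exists G, real G.
Hypothesis stability : forall H p q, shifted (degU H) du (degV H) dv p q ->
  exists2 G, real G & (#|sdiff H G| <= 12)%N.

(** A realization is kept, so that the lifts of [X] carry the value [f X]. For projections of
    near-perfect permutations the default [H] does not occur. *)
Definition round H := if real H then H else odflt H [pick G | real G && (#|sdiff H G| <= 12)%N].

Lemma roundP s : near s -> real (round (proj s)) /\ (#|sdiff (proj s) (round (proj s))| <= 12)%N.
Proof.
move=> ns; rewrite /round; case: ifP => [realH|_].
  by split=> //; have /eqP -> : #|sdiff (proj s) (proj s)| == 0%N by rewrite sdiff_eq0.
case: pickP => [G /andP[] //|no] /=.
have [p [q sh]] := near_perfect_shifted du_m dv_n realizable ns.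
by have [G realG le] := stability sh; have := no G; rewrite realG le.
Qed.

Let N := #|{: T}|.
Let M := #|{: E}|.+1.
Let Gam := #|relabelings du dv|.

Lemma card_near_le Z k (A : pred {perm T}) :
  (forall s, A s -> near s && (#|sdiff (proj s) Z| <= k)%N) ->
  (#|A| <= M ^ k * (N ^ 2 * Gam))%N.
Proof.
move=> AP; apply: (@leq_trans (\sum_(H in [set H | #|sdiff H Z| <= k]%N) (N ^ 2 * Gam))).
  apply: (@leq_trans (\sum_(H in [set H | #|sdiff H Z| <= k]%N) #|[set s | near s && (proj s == H)]|)).
    rewrite -sum1_card (partition_big (@proj n m) (fun H => H \in [set H | (#|sdiff H Z| <= k)%N])) /=.
      apply: leq_sum => H HZ; rewrite sum1dep_card subset_leq_card //; apply/subsetP => s.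
      by rewrite !inE => /andP[/AP/andP[-> _] ->].
    by move=> s /AP/andP[_]; rewrite inE.
  by apply: leq_sum => H _; apply: card_near_lifts.
by rewrite sum_nat_const leq_mul2r card_sdiff_ball orbT.
Qed.

Lemma card_near_perfect : (#|near| <= #|[set X | real X]| * (M ^ 12 * (N ^ 2 * Gam)))%N.
Proof.
rewrite -[X in (X <= _)%N]sum1_card (partition_big (fun s => round (proj s)) (fun X => X \in [set X | real X])) /=.
  rewrite -sum_nat_const leq_sum // => X _; rewrite sum1dep_card cardsE.
  apply: (@card_near_le X) => s /= /andP[ns /eqP <-].
  by have [_ le] := roundP ns; apply/andP.
by move=> s ns; rewrite inE; have [] := roundP ns.
Qed.

Let g s := f (round (proj s)).

Lemma proj_tperm a b s : (#|sdiff (proj s) (proj (tperm a b * s)%g)| <= 2)%N.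
Proof.
apply: (@leq_trans #|[set a; b]|); last by rewrite cards2; case: eqP.
rewrite -(card_imset _ (f := @inl E E)); last by move=> ? ? [].
rewrite subset_leq_card //; apply/subsetP => _ /imsetP[e + ->].
rewrite in_sdiff !inE permM; case: tpermP => [->|->|]; rewrite ?eqxx ?orbT //.
Qed.

(** Two repairs differ in at most 26 = 12 + 2 + 12 pairs, so the swaps joining them stay within 104
    = 4 * 26 of the repaired graph and 116 = 12 + 104 of the projection. [N ^ 4] collects the
    choices of [a] and [b] and of the exceptional entry of a lift. *)
Lemma near_energy_le :
  near_energy (allowed du dv) g
    <= (4 ^ 26 * (N ^ 4 * (M ^ 116 * Gam)))%:R * swap_energy.
Proof.
apply: (@le_trans _ _ (\sum_(s | near s) \sum_(a : T) \sum_(b : T)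
    4 ^+ 26 * local_energy (round (proj s)) (4 * 26))).
  apply: ler_sum => s ns; apply: ler_sum => a _; rewrite big_mkcond /=; apply: ler_sum => b _.
  have L0 := local_energy_ge0 (round (proj s)) (4 * 26).
  case: ifP => [ns'|_]; last by rewrite mulr_ge0 // exprn_ge0.
  have [rs les] := roundP ns; have [rs' les'] := roundP ns'.
  apply: local_energy_bound => //.
  apply: leq_trans (sdiff_triangle _ (proj s) _) _; rewrite (leq_add (m1 := _) (n1 := 12)  (n2 := 14)) //.
    by rewrite sdiffC.
  apply: leq_trans (sdiff_triangle _ (proj (tperm a b * s)%g) _) _.
  exact: (leq_add (n1 := 2) (n2 := 12)) (proj_tperm _ _ _) les'.
have -> : \sum_(s | near s) \sum_(a : T) \sum_(b : T)
    4 ^+ 26 * local_energy (round (proj s)) (4 * 26) =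
  (4 ^ 26 * N ^ 2)%:R * \sum_(s | near s) local_energy (round (proj s)) (4 * 26).
  rewrite mulr_sumr; apply: eq_bigr => s _; rewrite !sumr_const -mulrnA mulnn -mulrnAl.
  by rewrite [in RHS]natrM natrX mulr_natr.
have -> : \sum_(s | near s) local_energy (round (proj s)) (4 * 26) =
  \sum_(Z | real Z) \sum_(s | near s && (#|sdiff (round (proj s)) Z| <= 4 * 26)%N)
     \sum_(W | real W && swap_step Z W) (f Z - f W) ^+ 2.
  rewrite /local_energy (exchange_big_dep real) //=; first last.
    by move=> s Z _ /andP[].
  by apply: eq_bigr => Z realZ; apply: eq_bigl => s; rewrite realZ.
have bound Z : (#|[pred s | near s && (#|sdiff (round (proj s)) Z| <= 4 * 26)%N]|
    <= M ^ 116 * (N ^ 2 * Gam))%N.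
  apply: (@card_near_le Z) => s /= /andP[ns le]; rewrite ns /=.
  have [_ les] := roundP ns.
  apply: leq_trans (sdiff_triangle _ (round (proj s)) _) _.
  exact: (leq_add (n1 := 12) (n2 := 104)).
rewrite (_ : (4 ^ 26 * (N ^ 4 * (M ^ 116 * Gam)) = 4 ^ 26 * N ^ 2 * (M ^ 116 * (N ^ 2 * Gam)))%N);
  last by rewrite (expnD N 2 2); lia.
rewrite [X in _ <= X * _]natrM -mulrA ler_wpM2l ?ler0n // mulr_sumr.
apply: ler_sum => Z _; rewrite sumr_const -[X in X <= _]mulr_natl.
apply: ler_wpM2r; last by rewrite ler_nat; apply: bound.
by apply: sumr_ge0 => W _; apply: sqr_ge0.
Qed.

(** Relabeling one chosen lift of each realization gives [Gam] distinct perfect lifts with the same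
    value of [g]. *)
Lemma lifted_pairs :
  (Gam ^ 2)%:R * \sum_(X | real X) \sum_(Y | real Y) (f X - f Y) ^+ 2 <=
  \sum_(s | perfect s) \sum_(t | perfect t) (g s - g t) ^+ 2.
Proof.
have lift X : exists s, real X ==> perfect s && (proj s == X).
  case: (boolP (real X)) => [/(lift_exists du_m dv_n)[s ps <-]|_].
    by exists s; rewrite ps eqxx.
  by exists 1%g.
pose sg X := xchoose (lift X).
have sgP X : real X -> perfect (sg X) /\ proj (sg X) = X.
  by move=> realX; have /implyP/(_ realX)/andP[? /eqP] := xchooseP (lift X).
pose r (q : {set E} * ({perm T} * {perm T})) := relabel q.2 (sg q.1).
pose P (q : {set E} * ({perm T} * {perm T})) := real q.1 && (q.2 \in relabelings du dv).
have rP q : P q -> [/\ perfect (r q), proj (r q) = q.1 & g (r q) = f q.1].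
  move=> /andP[realX qG]; have [ps pX] := sgP _ realX.
  have pr : proj (r q) = q.1 by rewrite /r (relabel_proj _ qG).
  by split=> //; [apply: relabel_perfect|rewrite /g pr /round realX].
have r_inj : {in P &, injective r}.
  move=> [X k] [Y l] Pq Pq' E; have [_ pX _] := rP _ Pq; have [_ pY _] := rP _ Pq'.
  have XY : X = Y by rewrite -[X]pX E pY.
  subst Y; case/andP: Pq Pq' => /= realX kG /andP[_ /= lG].
  by rewrite (relabel_inj (proj1 (sgP _ realX)) kG lG E).
have pairs h : \sum_(X | real X) \sum_(k in relabelings du dv) h X = Gam%:R * \sum_(X | real X) h X :> F.
  by rewrite mulr_sumr; apply: eq_bigr => X _; rewrite sumr_const mulr_natl.
have le1 (h : {perm T} -> F) (h' : {set E} -> F) : (forall s, 0 <= h s) ->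
    (forall q, P q -> h (r q) = h' q.1) ->
    Gam%:R * \sum_(X | real X) h' X <= \sum_(s | perfect s) h s.
  move=> h0 hh'; rewrite -pairs pair_big_dep /=.
  rewrite -(eq_bigr _ hh'); apply: sum_inj_le => //.
  by move=> q Pq; have [] := rP q Pq.
rewrite expnS expn1 natrM -mulrA.
apply: le_trans (le1 (fun s => \sum_(t | perfect t) (g s - g t) ^+ 2)
  (fun X => \sum_(t | perfect t) (f X - g t) ^+ 2) _ _).
- rewrite ler_wpM2l ?ler0n // mulr_sumr ler_sum // => X _.
  apply: le1 => [t|q Pq]; first exact: sqr_ge0.
  by have [_ _ ->] := rP q Pq.
- by move=> s; apply: sumr_ge0 => t _; apply: sqr_ge0.
- by move=> q Pq; apply: eq_bigr => t _; have [_ _ ->] := rP q Pq.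
Qed.

(** With [4 <= M ^ 2] and [N <= M ^ 2], what is left after cancelling [Gam ^ 2], namely
    [4 ^ 26 * N ^ 11 * M ^ 128], is at most [M ^ 202]. *)
Theorem poincare_swaps : (0 < n)%N -> (0 < m)%N ->
  \sum_(X | real X) \sum_(Y | real Y) (f X - f Y) ^+ 2
    <= (M ^ 202 * #|[set X | real X]|)%:R * swap_energy.
Proof.
move=> n0 m0.
have Gam0 : 0 < (Gam ^ 2)%:R :> F.
  rewrite ltr0n expn_gt0; apply/orP; left; apply/card_gt0P; exists (1%g, 1%g).
  by rewrite inE; apply/andP; split; apply/forallP => x; rewrite perm1.
have en0 : 0 <= swap_energy.
  by apply: sumr_ge0 => Z _; apply: sumr_ge0 => W _; apply: sqr_ge0.
rewrite -(ler_pM2l Gam0); apply: le_trans lifted_pairs _.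
apply: le_trans (perfect_pairs_energy _ _) _.
apply: le_trans (ler_wpM2l (ler0n _ _) near_energy_le) _.
rewrite !mulrA -!natrM ler_wpM2r // ler_nat.
apply: leq_trans (leq_mul (leq_mul (leqnn _) card_near_perfect) (leqnn _)) _.
have M2 : (2 <= M)%N by rewrite /M card_prod !card_ord ltnS muln_gt0 n0.
have NM : (N <= M ^ 2)%N.
  apply: (@leq_trans (2 * M)%N); first by rewrite /N card_sum addnn -muln2 mulnC leq_mul2l leqnSn.
  by rewrite expnS expn1 leq_mul2r M2 orbT.
have M4 : (4 <= M ^ 2)%N by rewrite (@leq_exp2r 2 M 2).
set O := #|[set X | real X]|.
have -> : (N ^ 5 * (O * (M ^ 12 * (N ^ 2 * Gam))) * (4 ^ 26 * (N ^ 4 * (M ^ 116 * Gam))) =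
          (4 ^ 26 * N ^ 11 * M ^ 128) * (Gam ^ 2 * O))%N.
  rewrite -[11%N]/(5 + 2 + 4)%N -[128%N]/(12 + 116)%N !expnD.
  move: (4 ^ 26)%N (N ^ 5)%N (N ^ 4)%N (N ^ 2)%N (M ^ 12)%N (M ^ 116)%N => a b c d e k.
  by rewrite (expnS Gam 1) expn1; ring.
rewrite [X in (_ <= X)%N]mulnCA leq_mul2r; apply/orP; right.
rewrite -[202%N]/(2 * 26 + 2 * 11 + 128)%N !expnD !expnM leq_mul2r.
by rewrite leq_mul ?orbT // leq_exp2r.
Qed.

End Compare.

(** * Mixing *)

Section Variance.
Local Open Scope ring_scope.
Variables (F : realFieldType) (S : finType) (A : pred S).

Lemma sum_pairs_sqr (f : S -> F) :
  \sum_(X | A X) \sum_(Y | A Y) (f X - f Y) ^+ 2 =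
  2 * (#|A|%:R * \sum_(X | A X) f X ^+ 2 - (\sum_(X | A X) f X) ^+ 2).
Proof.
set S1 := \sum_(X | A X) f X; set S2 := \sum_(X | A X) f X ^+ 2.
have inner X : \sum_(Y | A Y) (f X - f Y) ^+ 2 = #|A|%:R * f X ^+ 2 + (S2 - 2 * S1 * f X).
  transitivity (\sum_(Y | A Y) (f X ^+ 2 + (f Y ^+ 2 - 2 * f X * f Y))).
    by apply: eq_bigr => Y _; ring.
  rewrite big_split /= sumr_const sumrB -mulr_sumr -/S1 -/S2 -[f X ^+ 2 *+ _]mulr_natl.
  by ring.
rewrite (eq_bigr _ (fun X _ => inner X)) big_split /= sumrB -!mulr_sumr -/S1 -/S2.
by rewrite sumr_const -[S2 *+ _]mulr_natl; ring.
Qed.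

Lemma sqr_sum_le_card (f : S -> F) :
  (\sum_(X | A X) f X) ^+ 2 <= #|A|%:R * \sum_(X | A X) f X ^+ 2.
Proof.
have : 0 <= \sum_(X | A X) \sum_(Y | A Y) (f X - f Y) ^+ 2.
  by apply: sumr_ge0 => X _; apply: sumr_ge0 => Y _; apply: sqr_ge0.
by rewrite sum_pairs_sqr pmulr_rge0 ?ltr0n // subr_ge0.
Qed.

End Variance.

(** * Contraction of a lazy symmetric chain *)

Section Contraction.
Local Open Scope ring_scope.
Variables (F : realFieldType) (S : finType) (A : pred S) (w : rel S).
Hypothesis w_sym : symmetric w.

Definition energy (f : S -> F) := \sum_(X | A X) \sum_(Y | A Y && w X Y) (f X - f Y) ^+ 2.

(** The operator [I - p L] on functions, with [L] the graph Laplacian; by symmetry it also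
    transports distributions. *)
Definition chain_step (p : F) (f : S -> F) X := f X + p * \sum_(Y | A Y && w X Y) (f Y - f X).

Lemma energy_sym (f : S -> F) :
  \sum_(X | A X) f X * (\sum_(Y | A Y && w X Y) (f Y - f X)) = - (2^-1 * energy f).
Proof.
set D := LHS.
have DE : D = \sum_(X | A X) \sum_(Y | A Y && w X Y) f X * (f Y - f X).
  by apply: eq_bigr => X _; rewrite mulr_sumr.
have DE' : D = \sum_(X | A X) \sum_(Y | A Y && w X Y) f Y * (f X - f Y).
  rewrite DE (exchange_big_dep A) /=; last by move=> X Y _ /andP[].
  apply: eq_bigr => X AX; apply: eq_bigl => Y.
  by rewrite AX w_sym andTb.
have : D + D = - energy f.
  rewrite {1}DE DE' -big_split /energy /= -sumrN; apply: eq_bigr => X _.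
  by rewrite -big_split -sumrN; apply: eq_bigr => Y _ /=; ring.
move=> H; have -> : energy f = - (D + D) by rewrite H opprK.
by field.
Qed.

(** Summation by parts turns the cross term into [- p * energy f]; laziness and Cauchy-Schwarz bound
    the quadratic term by half of that, which also takes care of eigenvalues near -1. *)
Lemma chain_step_sqr (p : F) (f : S -> F) : 0 <= p ->
  (forall X, A X -> p * #|[pred Y | A Y && w X Y]|%:R <= 2^-1) ->
  \sum_(X | A X) chain_step p f X ^+ 2 <= \sum_(X | A X) f X ^+ 2 - 2^-1 * p * energy f.
Proof.
move=> p0 lazy.
pose d X := \sum_(Y | A Y && w X Y) (f Y - f X).
have E X : chain_step p f X ^+ 2 = f X ^+ 2 + 2 * p * (f X * d X) + p ^+ 2 * d X ^+ 2.
  by rewrite /chain_step -/(d X); ring.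
under eq_bigr => X _ do rewrite E.
rewrite big_split big_split /= -!mulr_sumr energy_sym.
have : p ^+ 2 * \sum_(X | A X) d X ^+ 2 <= 2^-1 * p * energy f.
  rewrite /energy !mulr_sumr; apply: ler_sum => X AX.
  have cs := @sqr_sum_le_card F S (fun Y => A Y && w X Y) (fun Y => f Y - f X).
  have -> : \sum_(Y | A Y && w X Y) (f X - f Y) ^+ 2 = \sum_(Y | A Y && w X Y) (f Y - f X) ^+ 2.
    by apply: eq_bigr => Y _; rewrite -sqrrN opprB.
  have s0 : 0 <= \sum_(Y | A Y && w X Y) (f Y - f X) ^+ 2.
    by apply: sumr_ge0 => Y _; apply: sqr_ge0.
  have := lazy X AX; rewrite -/(d X) in cs *.
  move: (d X) (\sum_(Y | A Y && w X Y) _) (#|_|%:R) cs s0 => D Q K cs s0 pK.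
  apply: (@le_trans _ _ (p ^+ 2 * (K * Q))); first by rewrite ler_wpM2l ?sqr_ge0.
  have -> : p ^+ 2 * (K * Q) = p * K * (p * Q) by ring.
  by apply: le_trans (ler_wpM2r (mulr_ge0 p0 s0) pK) _; rewrite mulrA lexx.
move: (energy f) (\sum_(X | A X) f X ^+ 2) (\sum_(X | A X) d X ^+ 2) => e S2 D2 H.
lra.
Qed.

Lemma chain_step_sum (p : F) (f : S -> F) :
  \sum_(X | A X) chain_step p f X = \sum_(X | A X) f X.
Proof.
rewrite /chain_step big_split /= -mulr_sumr.
set D := (X in p * X).
suff -> : D = 0 by rewrite mulr0 addr0.
have : D = - D.
  rewrite {1}/D (exchange_big_dep A) /=; last by move=> X Y _ /andP[].
  rewrite -sumrN; apply: eq_bigr => X AX; rewrite -sumrN.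
  by apply: eq_big => [Y|Y _]; rewrite ?opprB // AX w_sym andTb.
by move=> H; lra.
Qed.

Lemma chain_step_contract (p B : F) (f : S -> F) : 0 <= p -> 0 < B ->
  (forall X, A X -> p * #|[pred Y | A Y && w X Y]|%:R <= 2^-1) ->
  \sum_(X | A X) \sum_(Y | A Y) (f X - f Y) ^+ 2 <= B * #|A|%:R * energy f ->
  \sum_(X | A X) f X = 0 -> (0 < #|A|)%N ->
  \sum_(X | A X) chain_step p f X ^+ 2 <= (1 - p / B) * \sum_(X | A X) f X ^+ 2.
Proof.
move=> p0 B0 lazy poin f0 A0; apply: le_trans (chain_step_sqr f p0 lazy) _.
move: poin; rewrite sum_pairs_sqr f0 expr0n subr0.
have A0' : 0 < #|A|%:R :> F by rewrite ltr0n.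
move: (\sum_(X | A X) f X ^+ 2) (energy f) (#|A|%:R) A0' => S2 e K K0 H.
have : 2 * S2 <= B * e by rewrite -(ler_pM2l K0); lra.
move=> H2; rewrite mulrBl mul1r lerD2l lerN2.
have -> : p / B * S2 = p * (S2 / B) by ring.
have -> : 2^-1 * p * e = p * (2^-1 * e) by ring.
by rewrite ler_wpM2l // ler_pdivrMr //; lra.
Qed.

Lemma iter_chain_step_sum (p : F) (f : S -> F) t :
  \sum_(X | A X) iter t (chain_step p) f X = \sum_(X | A X) f X.
Proof. by elim: t => [//|t IH]; rewrite iterS chain_step_sum. Qed.

Lemma iter_chain_step_contract (p B : F) (f : S -> F) t : 0 <= p -> 0 < B -> p <= B ->
  (forall X, A X -> p * #|[pred Y | A Y && w X Y]|%:R <= 2^-1) ->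
  (forall h : S -> F, \sum_(X | A X) \sum_(Y | A Y) (h X - h Y) ^+ 2 <= B * #|A|%:R * energy h) ->
  \sum_(X | A X) f X = 0 -> (0 < #|A|)%N ->
  \sum_(X | A X) iter t (chain_step p) f X ^+ 2 <= (1 - p / B) ^+ t * \sum_(X | A X) f X ^+ 2.
Proof.
move=> p0 B0 pB lazy poin f0 A0; elim: t => [|t IH]; first by rewrite expr0 mul1r.
rewrite exprS -mulrA.
apply: le_trans (chain_step_contract p0 B0 lazy (poin _) _ A0) _.
  by rewrite iter_chain_step_sum.
by rewrite ler_wpM2l // subr_ge0 ler_pdivrMr // mul1r.
Qed.

End Contraction.

(** * The swap chain and its distance to uniformity *)

Section SwapChain.
Local Open Scope ring_scope.
Variables (n m : nat) (du : 'I_n -> nat) (dv : 'I_m -> nat).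
Implicit Types (G H X Y Z K : {set 'I_n * 'I_m}).
Local Notation real := (realizes du dv).
Local Notation w := (@swap_step n m).
Local Notation p := (swap_prob n m : R).

Lemma swap_step_neq X Y : w X Y -> Y != X.
Proof.
move=> /swap_stepP[u1 [u2 [v1 [v2 [uu vv [H1 H2 H3 H4] ->]]]]].
apply/eqP => /setP/(_ (u1, v2)); rewrite in_swap_set //= !in_set2 !eqxx orbT.
by rewrite (negbTE H3).
Qed.

Lemma card_swap_nbrs X : (#|[set Y | w X Y]| <= 'C(n, 2) * 'C(m, 2))%N.
Proof.
pose rect (q : {set 'I_n} * {set 'I_m}) := sdiff X (setX q.1 q.2).
pose D := setX [set U : {set 'I_n} | #|U| == 2%N] [set V : {set 'I_m} | #|V| == 2%N].
have -> : ('C(n, 2) * 'C(m, 2) = #|D|)%N by rewrite cardsX !card_draws !card_ord.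
apply: leq_trans (leq_imset_card rect (mem D)); rewrite subset_leq_card //.
apply/subsetP => Y; rewrite inE => /swap_stepP[u1 [u2 [v1 [v2 [uu vv [H1 H2 H3 H4] ->]]]]].
apply/imsetP; exists ([set u1; u2], [set v1; v2]); first by rewrite !inE /= !cards2 uu vv.
apply/setP => -[u v]; rewrite in_swap_set // in_sdiff in_setX /=.
by case: (_ \in X); case: (_ && _).
Qed.

Lemma swap_probE : p = (2 * 'C(n, 2)%:R * 'C(m, 2)%:R)^-1.
Proof. by rewrite /swap_prob !RealsE. Qed.

Lemma offdiagE X Y : offdiag X Y = if w X Y then p else 0.
Proof.
rewrite /offdiag; case: (boolP (w X Y)) => [XY|_]; last by rewrite andbF.
by rewrite swap_step_neq.
Qed.

(** The recursion sums over the last state before [X]; symmetry of the swap relation turns it into a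
    [chain_step] in the end point, with [G] fixed. *)
Lemma swapPtS t G X : real X ->
  swapPt du dv t.+1 G X = chain_step real w p (swapPt du dv t G) X.
Proof.
move=> realX; rewrite /= /chain_step.
rewrite (bigD1 X) //= {1}/swapP eqxx.
(* Swaps preserve degrees, so the holding probability, a sum over all graphs, only meets
   realizations. *)
have -> : \big[Rplus/R0]_(K | K != X) offdiag X K = \sum_(Y | real Y && w X Y) p.
  rewrite big_mkcond [RHS]big_mkcond; apply: eq_bigr => Y _; rewrite offdiagE.
  case: (boolP (w X Y)) => [XY|_]; last by rewrite andbF; case: ifP.
  by rewrite swap_step_neq // (swap_step_real XY realX).
have -> : \big[Rplus/R0]_(K | real K && (K != X)) Rmult (swapPt du dv t G K) (swapP K X) =
          \sum_(Y | real Y && w X Y) p * swapPt du dv t G Y.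
  rewrite big_mkcond [RHS]big_mkcond; apply: eq_bigr => Y _.
  case: (real Y) => //=; rewrite /swapP (eq_sym X) offdiagE swap_step_sym.
  case: (boolP (w X Y)) => [XY|_]; first by rewrite (negbTE (swap_step_neq XY)) /= RmultE mulrC.
  by case: (Y == X) => //=; rewrite RmultE mulr0.
rewrite !RealsE mulrBr mulr1 -addrA; congr (_ + _).
rewrite mulr_sumr mulr_sumr -sumrN addrC -big_split /=; apply: eq_bigr => Y _.
by rewrite mulrBr [in RHS](mulrC p (swapPt du dv t G X)).
Qed.

Definition deviation (G X : {set 'I_n * 'I_m}) : R := (if G == X then 1 else 0) - unif du dv.

Lemma swapPt_deviation t G X : real X ->
  swapPt du dv t G X - unif du dv = iter t (chain_step real w p) (deviation G) X.
Proof.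
elim: t X => [|t IH] X realX; first by rewrite /deviation /=; case: ifP.
rewrite swapPtS // iterS /chain_step -IH // addrAC; congr (_ + _ * _).
by apply: eq_bigr => Y /andP[realY _]; rewrite -IH //; ring.
Qed.

Let O := #|[set X | real X]|.

Lemma unifE : unif du dv = O%:R^-1 :> R.
Proof. by rewrite /unif RealsE INRE. Qed.

Lemma sum_deviation G : real G -> \sum_(X | real X) deviation G X = 0.
Proof.
move=> realG; rewrite sumrB sumr_const unifE.
have -> : \sum_(X | real X) (if G == X then 1 else 0 : R) = 1.
  rewrite (bigD1 G) //= eqxx big1 ?addr0 // => X /andP[_ XG].
  by rewrite eq_sym (negbTE XG).
have O0 : O != 0%N by rewrite -lt0n; apply/card_gt0P; exists G; rewrite inE.
rewrite (_ : #|_| = O); last by rewrite /O cardsE.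
by rewrite -[_^-1 *+ _]mulr_natr mulVf ?pnatr_eq0 // subrr.
Qed.

Lemma sum_deviation_sqr G : real G -> \sum_(X | real X) deviation G X ^+ 2 <= 1.
Proof.
move=> realG.
have -> : \sum_(X | real X) deviation G X ^+ 2 =
   \sum_(X | real X) ((if G == X then 1 else 0) * deviation G X) -
   unif du dv * \sum_(X | real X) deviation G X.
  by rewrite mulr_sumr -sumrB; apply: eq_bigr => X _; rewrite -mulrBl expr2.
rewrite sum_deviation // mulr0 subr0 (bigD1 G) //= eqxx big1 ?addr0; last first.
  by move=> X /andP[_ XG]; rewrite eq_sym (negbTE XG) mul0r.
rewrite mul1r /deviation eqxx unifE lerBlDr lerDl invr_ge0 ler0n //.
Qed.

Lemma tv_dist_sqr t G : real G ->
  (2 * tv_dist du dv t G) ^+ 2 <=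
  O%:R * \sum_(X | real X) iter t (chain_step real w p) (deviation G) X ^+ 2.
Proof.
move=> realG.
have -> : 2 * tv_dist du dv t G = \sum_(X | real X) `|iter t (chain_step real w p) (deviation G) X|.
  rewrite /tv_dist !RealsE mulrA divff ?mul1r ?pnatr_eq0 //.
  by apply: eq_bigr => X realX; rewrite RabsE RminusE swapPt_deviation.
apply: le_trans (sqr_sum_le_card _ _) _.
rewrite /O cardsE ler_wpM2l ?ler0n //.
by rewrite le_eqVlt; apply/orP; left; apply/eqP; apply: eq_bigr => X _; rewrite real_normK ?num_real.
Qed.

Let M := (n * m).+1.

(** Passing from squared to absolute deviations costs a factor [O]; only its logarithm, at most
    [n * m], enters the mixing time. *)
Lemma card_realizations : Rle (INR O) (exp (INR (n * m))).
Proof.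
apply: (Rle_trans _ (pow 2 (n * m))); last exact: two_pow_le_exp.
apply/RleP; rewrite !RealsE -natrX ler_nat.
apply: leq_trans (max_card _) _.
by rewrite -cardsT -powersetT card_powerset cardsT card_prod !card_ord.
Qed.

Hypotheses (n_gt1 : (1 < n)%N) (m_gt1 : (1 < m)%N).

Lemma swap_prob_gt0 : 0 < p.
Proof. by rewrite swap_probE invr_gt0 !mulr_gt0 ?ltr0n ?bin_gt0. Qed.

Lemma swap_lazy X : p * #|[pred Y | real Y && w X Y]|%:R <= 2^-1.
Proof.
have le : (#|[pred Y | real Y && w X Y]| <= 'C(n, 2) * 'C(m, 2))%N.
  apply: leq_trans (card_swap_nbrs X); rewrite subset_leq_card //.
  by apply/subsetP => Y; rewrite !inE => /andP[].
apply: (@le_trans _ _ (p * ('C(n, 2) * 'C(m, 2))%:R)).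
  by rewrite ler_wpM2l ?ler_nat // ltW // swap_prob_gt0.
rewrite swap_probE natrM -mulrA invfM -mulrA mulVf ?mulr1 //.
by rewrite mulf_neq0 // pnatr_eq0 -lt0n bin_gt0.
Qed.

(** The reciprocal of [p] is at most [n^2 m^2 <= M^2], whence 204 = 202 + 2. *)
Lemma swap_prob_ge : ((M ^ 204)%:R)^-1 <= p / (M ^ 202)%:R :> R.
Proof.
have C0 : (0 < 2 * 'C(n, 2) * 'C(m, 2))%N by rewrite !muln_gt0 !bin_gt0 n_gt1.
rewrite swap_probE -invfM -!natrM lef_pV2; first last.
- by rewrite posrE ltr0n muln_gt0 C0 expn_gt0.
- by rewrite posrE ltr0n expn_gt0.
rewrite ler_nat -[204%N]/(2 + 202)%N expnD leq_mul2r; apply/orP; right.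
have bin2_le k : (2 * 'C(k, 2) <= k * k)%N.
  by rewrite mulnC muln2 bin2 halfK leq_subLR; apply: leq_trans (leq_addl _ _); rewrite leq_mul2l leq_pred orbT.
apply: (@leq_trans ((n * n) * (m * m))%N).
  by apply: leq_mul => //; apply: leq_trans (bin2_le m); rewrite leq_pmull.
by rewrite mulnACA mulnn leq_exp2r.
Qed.

Hypothesis poincare : forall h : {set 'I_n * 'I_m} -> R,
  \sum_(X | real X) \sum_(Y | real Y) (h X - h Y) ^+ 2
    <= (M ^ 202)%:R * #|real|%:R * energy real w h.

Lemma tv_dist_le t G : real G ->
  (2 * tv_dist du dv t G) ^+ 2 <= O%:R * (1 - ((M ^ 204)%:R)^-1) ^+ t.
Proof.
move=> realG; apply: le_trans (tv_dist_sqr t realG) _.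
rewrite ler_wpM2l ?ler0n //.
have B0 : 0 < (M ^ 202)%:R :> R by rewrite ltr0n expn_gt0.
have pB : p <= (M ^ 202)%:R.
  apply: (@le_trans _ _ 1); last by rewrite ler1n expn_gt0.
  rewrite swap_probE invf_le1 ?mulr_gt0 ?ltr0n ?bin_gt0 //.
  by rewrite -!natrM ler1n !muln_gt0 !bin_gt0 n_gt1.
have real0 : (0 < #|real|)%N by apply/card_gt0P; exists G.
have := iter_chain_step_contract (@swap_step_sym n m) t (ltW swap_prob_gt0) B0 pB
  (fun X _ => swap_lazy X) poincare (sum_deviation realG) real0.
move=> /le_trans; apply.
apply: (@le_trans _ _ ((1 - p / (M ^ 202)%:R) ^+ t)).
  rewrite ler_piMr ?sum_deviation_sqr // exprn_ge0 // subr_ge0 ler_pdivrMr // mul1r //.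
rewrite lerXn2r ?nnegrE ?subr_ge0 ?ler_pdivrMr ?mul1r //.
  by rewrite invf_le1 ?ltr0n ?expn_gt0 // ler1n expn_gt0.
by rewrite lerD2l lerN2 swap_prob_ge.
Qed.

End SwapChain.

Local Open Scope ring_scope.

(** Both [a * b + 1] and [a * b + 2 * l] are at most the square of [a + b + l + 1]; the factor 2
    absorbs the final 1. *)
Lemma time_bound (F : realFieldType) (a b l : F) : 0 <= a -> 0 <= b -> 0 <= l ->
  (a * b + 1) ^+ 204 * (a * b + 2 * l) + 1 <= 2 * (a + b + l + 1) ^+ (2 * 204 + 2).
Proof.
move=> a0 b0 l0; set x := a + b + l + 1.
have ab0 : 0 <= a * b by rewrite mulr_ge0.
have x1 : 1 <= x by rewrite /x; lra.
have x0 : 0 <= x by apply: le_trans x1.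
have H1 : a * b + 1 <= x ^+ 2 by rewrite /x; nra.
have H2 : a * b + 2 * l <= x ^+ 2 by rewrite /x; nra.
have H3 : (a * b + 1) ^+ 204 * (a * b + 2 * l) <= x ^+ (2 * 204 + 2).
  rewrite exprD exprM ler_pM //; first by rewrite exprn_ge0 // addr_ge0.
    by rewrite addr_ge0 // mulr_ge0.
  by rewrite lerXn2r ?nnegrE ?addr_ge0 ?exprn_ge0.
have H4 : 1 <= x ^+ (2 * 204 + 2) by apply: exprn_ege1.
move: (x ^+ (2 * 204 + 2)) ((a * b + 1) ^+ 204 * _) H3 H4 => y z H3 H4; lra.
Qed.

Theorem theorem2 :
  exists (C : R) (k : nat),
  forall (n m c1 c2 d1 d2 : nat) (du : 'I_n -> nat) (dv : 'I_m -> nat),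
    (0 < c1)%N -> (c1 <= c2)%N -> (c2 < n)%N ->
    (0 < d1)%N -> (d1 <= d2)%N -> (d2 < m)%N ->
    (exists G : {set 'I_n * 'I_m}, realizes du dv G) ->
    (forall v : 'I_m, (c1 <= dv v <= c2)%N) ->
    (forall u : 'I_n, (d1 <= du u <= d2)%N) ->
    ((Z.of_nat c2 - Z.of_nat c1 - 1) * (Z.of_nat d2 - Z.of_nat d1 - 1)
       <= Z.max (Z.of_nat c1 * (Z.of_nat m - Z.of_nat d2))
                (Z.of_nat d1 * (Z.of_nat n - Z.of_nat c2)))%Z ->
    forall eps : R, Rlt R0 eps -> Rlt eps R1 ->
    forall G : {set 'I_n * 'I_m}, realizes du dv G ->
    exists t : nat,
      Rle (INR t) (Rmult C (pow (Rplus (Rplus (INR (n + m)) (ln (Rinv eps))) R1) k)) /\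
      Rle (tv_dist du dv t G) eps.
Proof.
exists (IZR 2), (2 * 204 + 2)%N.
move=> n m c1 c2 d1 d2 du dv c1_gt0 c12 c2n d1_gt0 d12 d2m real_ex dvb dub hyp eps eps0 eps1 G realG.
have n_gt1 : (1 < n)%N by apply: leq_ltn_trans c2n; apply: leq_trans c12.
have m_gt1 : (1 < m)%N by apply: leq_ltn_trans d2m; apply: leq_trans d12.
have du_m r : (du r <= m)%N by have /andP[_ le] := dub r; apply: leq_trans le (ltnW d2m).
have dv_n c : (dv c <= n)%N by have /andP[_ le] := dvb c; apply: leq_trans le (ltnW c2n).
pose M := (n * m).+1.
have poincare (h : {set 'I_n * 'I_m} -> R) :
    \sum_(X | realizes du dv X) \sum_(Y | realizes du dv Y) (h X - h Y) ^+ 2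
    <= (M ^ 202)%:R * #|realizes du dv|%:R * energy (realizes du dv) (@swap_step n m) h.
  have stab := fun H p q => @stable n m c1 c2 d1 d2 du dv H p q c1_gt0 c12 c2n d1_gt0 d12 d2m dvb dub hyp real_ex.
  have := @poincare_swaps n m du dv R h du_m dv_n real_ex stab (ltnW n_gt1) (ltnW m_gt1).
  by rewrite natrM card_prod !card_ord cardsE.
have [||||||t [t_le tv_le]] := @exists_mixing_time (INR (M ^ 204)) (INR #|[set X | realizes du dv X]|)
   (INR (n * m)) eps.
- by apply/RleP; rewrite !RealsE ler1n expn_gt0.
- by apply/RleP; rewrite !RealsE ler0n.
- exact: card_realizations.
- by apply/RleP; rewrite !RealsE ler0n.
- exact: eps0.
- exact: eps1.
have l0 : 0 <= ln (/ eps).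
  by apply/RleP/Rlt_le/ln_Rinv_gt0.
exists t; split.
  apply: Rle_trans t_le _; apply/RleP; rewrite !RealsE natrD.
  have := @time_bound R n%:R m%:R (ln (/ eps)) (ler0n _ _) (ler0n _ _) l0.
  by rewrite /M natrX -[(n * m).+1]addn1 natrD natrM; apply: le_trans.
have le2 : (2 * tv_dist du dv t G) ^+ 2 <= eps ^+ 2.
  apply: le_trans (tv_dist_le n_gt1 m_gt1 poincare t realG) _.
  by move/RleP: tv_le; rewrite !RealsE.
apply/RleP; move/RltP: eps0 => eps0.
move: (tv_dist du dv t G) le2 eps0 => x le2 e0.
have : 0 < eps by [].
rewrite leNgt => e0'; apply/negP => lt; nra.
Qed.
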